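(* Let $G$ be a connected Lie group with locally convex Lie algebra $\mathfrak{g}$, and let $\mathfrak{t}\subseteq\mathfrak{g}$ be an elliptic Cartan subalgebra for which there exists a continuous $\mathfrak{t}$-equivariant linear projection $p_{\mathfrak{t}}:\mathfrak{g}\to\mathfrak{t}$. Then: (i) If $C\subseteq\mathfrak{g}$ is open, $\mathrm{Ad}(G)$-invariant and convex, then $p_{\mathfrak{t}}(C)=C\cap\mathfrak{t}$. (ii) If $C\subseteq\mathfrak{g}'$ is semi-equicontinuous, weak-$*$-closed, convex and $\mathrm{Ad}^*(G)$-invariant, then $p_{\mathfrak{t}'}(C)=C\cap\mathfrak{t}'$.
   Context: $G$ may be infinite-dimensional (modelled on a locally convex space) and has an exponential function $\exp:\mathfrak{g}\to G$. $\mathrm{Ad}$ is the adjoint action of $G$ on $\mathfrak{g}$; $\mathfrak{g}'$ is the topological dual with the weak-$*$-topology, and $\mathrm{Ad}^*_g\lambda=\lambda\circ\mathrm{Ad}_{g^{-1}}$. An abelian subalgebra $\mathfrak{t}\subseteq\mathfrak{g}$ is an elliptic Cartan subalgebra if it is maximal abelian, the spaces $\mathfrak{g}_{\mathbb{C}}^\alpha=\{x\in\mathfrak{g}_{\mathbb{C}}:[h,x]=\alpha(h)x\ \forall h\in\mathfrak{t}_{\mathbb{C}}\}$, $\alpha\in\mathfrak{t}_{\mathbb{C}}^*$ (with $\mathfrak g_{\mathbb C}^0=\mathfrak t_{\mathbb C}$), span a dense subspace $\mathfrak{g}^{\rm alg}_{\mathbb{C}}$ of the complexification $\mathfrak{g}_{\mathbb{C}}$,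 and $\alpha(\mathfrak{t})\subseteq i\mathbb{R}$ for every root $\alpha\in\Delta=\{\alpha\in\mathfrak{t}_{\mathbb{C}}^*\setminus\{0\}:\mathfrak{g}_{\mathbb{C}}^\alpha\ne\{0\}\}$. The projection $p_{\mathfrak{t}}$ is the continuous projection onto $\mathfrak{t}$ whose complex linear extension vanishes on all root spaces $\mathfrak{g}_{\mathbb{C}}^\alpha$, $\alpha\in\Delta$. The dual $\mathfrak{t}'$ is identified with the subspace $(\ker p_{\mathfrak{t}})^\perp\subseteq\mathfrak{g}'$ of functionals vanishing on $\ker p_{\mathfrak t}$ (via $\mu\mapsto\mu\circ p_{\mathfrak{t}}$), and $p_{\mathfrak{t}'}:\mathfrak{g}'\to\mathfrak{t}'$, $\lambda\mapsto\lambda|_{\mathfrak{t}}$ is the restriction map. A subset $C\subseteq\mathfrak{g}'$ is semi-equicontinuous if $s_C(x)=\sup_{\lambda\in C}\lambda(x)$ is bounded on some non-empty open subset of $\mathfrak{g}$. *)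

(* Defs.v *)
From HB Require Import structures.
From mathcomp Require Import all_boot all_order all_algebra.
From mathcomp Require Import all_classical all_reals all_analysis.
From mathcomp.real_closed Require Import complex.

Set Implicit Arguments.
Unset Strict Implicit.
Unset Printing Implicit Defensive.

Import Order.TTheory GRing.Theory Num.Theory.
Import numFieldTopology.Exports numFieldNormedType.Exports.

Local Open Scope classical_set_scope.
Local Open Scope ring_scope.

(* Differential calculus between locally convex spaces (Michal-Bastiani):
   f is C^0 on the open set U if it is continuous there, and C^(k+1) if moreover
   all directional derivatives exist on U and (x, v) |-> df(x)(v) is C^k on
   U x E.  The library's 'D_v f requires normed spaces. *)
Section Calculus.
Context {R : realType}.

Definition has_dderive (E F : tvsType R) (f : E -> F) (x v : E) (l : F) :=
  h^-1 *: (f (x + h *: v) - f x) @[h --> (0 : R)^'] --> l.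

Definition dderive (E F : tvsType R) (f : E -> F) (x v : E) : F :=
  xget 0 [set l | has_dderive f x v l].

Fixpoint class_C (k : nat) (F E : tvsType R) (U : set E) (f : E -> F) : Prop :=
  {within U, continuous f} /\
  if k is k'.+1 then
    exists2 df : E * E -> F,
      (forall x v, U x -> has_dderive f x v (df (x, v)))
      & @class_C k' F (E * E)%type (U `*` setT) df
  else True.

Definition smooth_on (E F : tvsType R) (U : set E) (f : E -> F) :=
  forall k, class_C k U f.

End Calculus.

Section Charts.
Context {R : realType}.

(* A chart is a homeomorphism from an open subset of M onto an open subset of
   E; the values of chart_fun off chart_dom, and of chart_inv off the image,
   are irrelevant. *)
Record chart (E : tvsType R) (M : topologicalType) := Chart {
  chart_dom : set M ;
  chart_fun : M -> E ;
  chart_inv : E -> M ;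
  chart_dom_open : open chart_dom ;
  chart_img_open : open (chart_fun @` chart_dom) ;
  chart_funK : forall x, chart_dom x -> chart_inv (chart_fun x) = x ;
  chart_fun_continuous : {within chart_dom, continuous chart_fun} ;
  chart_inv_continuous : {within chart_fun @` chart_dom, continuous chart_inv} }.

Definition chart_img (E : tvsType R) (M : topologicalType) (c : chart E M) :=
  chart_fun c @` chart_dom c.

Definition smooth_map (E F : tvsType R) (M N : topologicalType)
    (A : set (chart E M)) (B : set (chart F N)) (f : M -> N) :=
  continuous f /\
  forall c d, A c -> B d ->
    smooth_on (chart_img c `&` [set a | chart_dom d (f (chart_inv c a))])
      (fun a => chart_fun d (f (chart_inv c a))).

Section Product.
Variables (E F : tvsType R) (M N : topologicalType).
Variables (c : chart E M) (d : chart F N).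

Let pdom := chart_dom c `*` chart_dom d.
Let pfun (x : M * N) : E * F := (chart_fun c x.1, chart_fun d x.2).
Let pinv (a : E * F) : M * N := (chart_inv c a.1, chart_inv d a.2).

Let pimg : pfun @` pdom = chart_img c `*` chart_img d.
Proof.
apply/seteqP; split=> [_ [[x y] [/= cx dy] <-]|[a b] [/= [x cx <-] [y dy <-]]].
  by split; [exists x|exists y].
by exists (x, y).
Qed.

Let setX_open (S T : topologicalType) (A : set S) (B : set T) :
  open A -> open B -> open (A `*` B).
Proof.
move=> oA oB; rewrite openE => -[x y] [/= Ax By].
by exists (A, B) => //; split; exact: open_nbhs_nbhs.
Qed.

Let within_pair (S T S' T' : topologicalType) (A : set S) (B : set T)
    (f : S -> S') (g : T -> T') : open A -> open B ->
  {within A, continuous f} -> {within B, continuous g} ->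
  {within A `*` B, continuous (fun z => (f z.1, g z.2))}.
Proof.
move=> oA oB cf cg; rewrite continuous_open_subspace; last exact: setX_open.
rewrite continuous_open_subspace// in cf.
rewrite continuous_open_subspace// in cg.
move=> [x y]; rewrite inE => -[/= Ax By].
have fx : f z.1 @[z --> (x, y)] --> f x.
  by apply: (@cvg_comp _ _ _ fst f); [exact: cvg_fst|apply: cf; rewrite inE].
have gy : g z.2 @[z --> (x, y)] --> g y.
  by apply: (@cvg_comp _ _ _ snd g); [exact: cvg_snd|apply: cg; rewrite inE].
exact: cvg_pair fx gy.
Qed.

Let pdom_open : open pdom.
Proof. by apply: setX_open; exact: chart_dom_open. Qed.

Let pimg_open : open (pfun @` pdom).
Proof. by rewrite pimg; apply: setX_open; exact: chart_img_open. Qed.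

Let pfunK x : pdom x -> pinv (pfun x) = x.
Proof. by case: x => x y [/= cx dy]; rewrite /pinv /= !chart_funK. Qed.

Let pfun_continuous : {within pdom, continuous pfun}.
Proof.
by apply: within_pair; [exact: chart_dom_open|exact: chart_dom_open
  |exact: chart_fun_continuous|exact: chart_fun_continuous].
Qed.

Let pinv_continuous : {within pfun @` pdom, continuous pinv}.
Proof.
by rewrite pimg; apply: within_pair; [exact: chart_img_open|exact: chart_img_open
  |exact: chart_inv_continuous|exact: chart_inv_continuous].
Qed.

Definition prod_chart : chart (E * F)%type (M * N)%type :=
  Chart pdom_open pimg_open pfunK pfun_continuous pinv_continuous.

End Product.

Definition prod_atlas (E F : tvsType R) (M N : topologicalType)
    (A : set (chart E M)) (B : set (chart F N)) :
    set (chart (E * F)%type (M * N)%type) :=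
  [set e | exists c d, [/\ A c, B d & e = prod_chart c d]].

Section Model.
Variable E : tvsType R.

Let img_open : open ((id : E -> E) @` [set: E]).
Proof. by rewrite image_id; exact: openT. Qed.

Let within_id (A : set E) : {within A, continuous (id : E -> E)}.
Proof. by apply: continuous_subspaceT => x; exact: cvg_id. Qed.

Definition id_chart : chart E E :=
  Chart openT img_open (fun _ _ => erefl) (@within_id _) (@within_id _).

End Model.
End Charts.

HB.mixin Record isLieGroup (R : realType) (E : tvsType R) G
    & Topological G & Group G := {
  lie_atlas : set (chart E G) ;
  lie_hausdorff : hausdorff_space G ;
  lie_atlas_cover : forall g : G, exists2 c, lie_atlas c & chart_dom c g ;
  lie_atlas_compatible : smooth_map lie_atlas lie_atlas (id : G -> G) ;
  lie_mul_smooth : smooth_map (prod_atlas lie_atlas lie_atlas) lie_atlas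
    (fun z : G * G => (z.1 * z.2)%g) ;
  lie_inv_smooth : smooth_map lie_atlas lie_atlas (fun g : G => (g^-1)%g) }.

#[short(type="lieGroupType")]
HB.structure Definition LieGroup (R : realType) (E : tvsType R) :=
  {G of Topological G & Group G & isLieGroup R E G}.

(* A chart c at 1 identifies the tangent space T_1 G, hence the Lie algebra of
   G, with the model space E.  The bracket is that of the left-invariant vector
   fields, evaluated at 1; everything is read in the chart c. *)
Section LieAlgebra.
Context {R : realType} {E : tvsType R} {G : lieGroupType E}.
Variable c : chart E G.

Definition chart_at_one := lie_atlas c /\ chart_dom c 1%g.

Definition left_field (x : E) (a : E) : E :=
  dderive (fun b => chart_fun c (chart_inv c a * chart_inv c b)%g)
    (chart_fun c 1%g) x.

Definition field_bracket (X Y : E -> E) (a : E) : E :=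
  dderive Y a (X a) - dderive X a (Y a).

Definition lie_bracket (x y : E) : E :=
  field_bracket (left_field x) (left_field y) (chart_fun c 1%g).

Definition Ad (g : G) (x : E) : E :=
  dderive (fun a => chart_fun c (g * chart_inv c a * g^-1)%g)
    (chart_fun c 1%g) x.

Definition is_exponential (e : E -> G) :=
  [/\ smooth_map [set id_chart E] lie_atlas e,
      forall (x : E) (s r : R), e ((s + r) *: x) = (e (s *: x) * e (r *: x))%g
    & forall x : E, has_dderive (fun s : R^o => chart_fun c (e (s *: x))) 0 1 x].

End LieAlgebra.

(* The complexification E + iE, the pair (x, y) standing for x + iy. *)
Definition complexify (E : Type) : Type := (E * E)%type.

Section Complexification.
Context {R : realType} {E : tvsType R}.

HB.instance Definition _ := Topological.copy (complexify E) (E * E)%type.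
HB.instance Definition _ := GRing.Zmodule.copy (complexify E) (E * E)%type.

Definition complex_scale (z : R[i]) (x : complexify E) : complexify E :=
  (complex.Re z *: x.1 - complex.Im z *: x.2, complex.Re z *: x.2 + complex.Im z *: x.1).

Let scaleA (a b : R[i]) (x : complexify E) :
  complex_scale a (complex_scale b x) = complex_scale (a * b) x.
Proof.
case: a b x => a a' [b b'] [x y]; rewrite /complex_scale /=.
congr pair; rewrite !scalerBr !scalerDr !scalerBl !scalerDl !scalerA.
  by rewrite [X in _ - X = _]addrC !opprD addrACA.
by rewrite [X in _ + X = _]addrC addrACA.
Qed.

Let scale1 : left_id 1 complex_scale.
Proof. by case=> x y; rewrite /complex_scale /= !scale1r !scale0r subr0 addr0. Qed.

Let scaleDr : right_distributive complex_scale +%R.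
Proof.
case=> a a' [x y] [x' y']; rewrite /complex_scale /=; congr pair => /=.
  by rewrite !scalerDr opprD addrACA.
by rewrite !scalerDr addrACA.
Qed.

Let scaleDl x : {morph complex_scale^~ x : a b / a + b}.
Proof.
case: x => x y [a a'] [b b']; rewrite /complex_scale /=; congr pair => /=.
  by rewrite !scalerDl opprD addrACA.
by rewrite !scalerDl addrACA.
Qed.

HB.instance Definition _ := GRing.Zmodule_isLmodule.Build R[i] (complexify E)
  scaleA scale1 scaleDr scaleDl.

End Complexification.

Section EllipticCartan.
Context {R : realType} {E : tvsType R}.
Variable br : E -> E -> E.
Local Notation EC := (complexify E).

Definition complex_bracket (x y : EC) : EC :=
  (br x.1 y.1 - br x.2 y.2, br x.1 y.2 + br x.2 y.1).

Definition abelian_subalgebra (t : set E) :=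
  submod_closed (mem t) /\ forall x y, t x -> t y -> br x y = 0.

Definition maximal_abelian (t : set E) :=
  abelian_subalgebra t /\
  forall s, abelian_subalgebra s -> t `<=` s -> s = t.

Definition complexify_set (t : set E) : set EC := t `*` t.

(* Functionals on t_C are represented by functions on the whole of g_C, of which
   only the restriction to t_C matters. *)
Definition tC_functional (t : set E) (alpha : EC -> R[i]) :=
  forall (a : R[i]) (x y : EC), complexify_set t x -> complexify_set t y ->
    alpha (a *: x + y) = a * alpha x + alpha y.

Definition root_space (t : set E) (alpha : EC -> R[i]) : set EC :=
  [set x | forall h, complexify_set t h -> complex_bracket h x = alpha h *: x].

Definition is_root (t : set E) (alpha : EC -> R[i]) :=
  [/\ tC_functional t alpha,
      exists2 h, complexify_set t h & alpha h != 0
    & exists2 x, root_space t alpha x & x != 0].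

Definition complex_span (S : set EC) : set EC :=
  [set x | exists n (a : 'I_n -> R[i]) (v : 'I_n -> EC),
    (forall i, S (v i)) /\ x = \sum_(i < n) a i *: v i].

Definition g_alg (t : set E) : set EC :=
  complex_span (\bigcup_(alpha in tC_functional t) root_space t alpha).

Definition elliptic_cartan (t : set E) :=
  [/\ maximal_abelian t,
      dense (g_alg t)
    & forall alpha, is_root t alpha ->
        forall h, t h -> complex.Re (alpha ((h, 0) : EC)) = 0].

Definition equivariant_projection (t : set E) (p : E -> E) :=
  [/\ range p = t, forall x, t x -> p x = x
    & forall h x, t h -> p (br h x) = br h (p x)].

End EllipticCartan.

Section Dual.
Context {R : realType} (E : tvsType R).

Definition dual_pred : {pred (E -> R^o)} :=
  mem [set f : E -> R^o | linear f /\ continuous f].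

Record dual := Dual { dual_fun :> E -> R^o ; _ : dual_fun \in dual_pred }.

HB.instance Definition _ := [isSub for dual_fun].
HB.instance Definition _ := [Choice of dual by <:].

Let dual_submod : submod_closed dual_pred.
Proof.
split=> [|a f g]; rewrite !inE /=.
  by split=> [b x y|]; [rewrite scaler0 addr0|exact: cst_continuous].
move=> [lf cf] [lg cg]; split=> [b x y|x].
  rewrite -[LHS]/(a *: f (b *: x + y) + g (b *: x + y)).
  rewrite -[RHS]/(b *: (a *: f x + g x) + (a *: f y + g y)).
  by rewrite lf lg !scalerDr !scalerA addrACA [a * b]mulrC.
have caf : {for x, continuous (a \*: f)} by apply: continuousZr; exact: cf.
exact: continuousD caf (cg x).
Qed.

HB.instance Definition _ :=
  GRing.isSubmodClosed.Build R (E -> R^o) dual_pred dual_submod.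
HB.instance Definition _ := [SubChoice_isSubLmodule of dual by <:].
(* The weak-* topology. *)
HB.instance Definition _ := Topological.copy dual
  (initial_topology (dual_fun : dual -> {ptws E -> R^o})).

End Dual.

Section Invariance.
Context {R : realType} {E : tvsType R} {G : lieGroupType E}.
Variable c : chart E G.

Definition Ad_invariant (C : set E) := forall g x, C x -> C (Ad c g x).

(* Ad^*_g l = l o Ad_(g^-1); the invariance hypothesis says that this functional
   is one of the elements of C. *)
Definition coAd_invariant (C : set (dual E)) :=
  forall g l, C l -> exists2 m, C m & forall x, m x = l (Ad c g^-1%g x).

End Invariance.

Section DualSets.
Context {R : realType} {E : tvsType R}.

Definition support_function (C : set (dual E)) (x : E) : \bar R :=
  ereal_sup [set (l x : R)%:E | l in C].

Definition semi_equicontinuous (C : set (dual E)) :=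
  exists U : set E, [/\ open U, U !=set0
    & exists M : R, forall x, U x -> (`|support_function C x| <= M%:E)%E].

Variables (p : {linear E -> E}) (pc : continuous p).

Let comp_dual (l : dual E) : (l : E -> R^o) \o p \in (@dual_pred R E).
Proof.
case: l => l /= + ; rewrite !inE => -[ll cl]; split=> [a x y|x] /=.
  by rewrite linearP ll.
by apply: continuous_comp; [exact: pc|exact: cl].
Qed.

(* When p is a projection onto t, this is the restriction of l to t, regarded
   as an element of E' through mu |-> mu o p. *)
Definition dual_restrict (l : dual E) : dual E := Dual (comp_dual l).

(* The image of t' in E' under mu |-> mu o p. *)
Definition ker_annihilator : set (dual E) :=
  [set l | forall x, p x = 0 -> l x = 0].

End DualSets.

(* Main.v *)
Require Import Defs.
From mathcomp Require Import all_boot all_order all_algebra.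
From mathcomp Require Import all_classical all_reals all_analysis.
From mathcomp.real_closed Require Import complex.
From mathcomp Require Import ring lra.
Import Order.TTheory GRing.Theory Num.Theory.
Import numFieldTopology.Exports numFieldNormedType.Exports.

Set Implicit Arguments.
Unset Strict Implicit.
Unset Printing Implicit Defensive.

Local Open Scope classical_set_scope.
Local Open Scope ring_scope.

(** The projection onto [t] is attained by averaging over the torus [exp t].

   For [h] in [t], [Ad (exp (s h))] has derivative [Ad (exp (s h)) (ad h)] in [s]
   ([Ad_flow]), so on the plane spanned by the real and imaginary part of a root
   vector, where [ad h] acts as multiplication by [i a], it is the rotation of angle
   [s a] ([Ad_rotation]).  If [a] is nonzero, the choice [s = pi / a] gives [- 1], and
   [(1 + Ad (exp (s h))) / 2] annihilates the plane, exactly as [p] does by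
   equivariance; the other root planes are preserved and [t] is fixed pointwise.
   Root vectors with zero root centralize [t], hence lie in [t] by maximality.
   Composing such averages, one obtains for any finitely many elements of the dense
   subspace of algebraic vectors an average that agrees with [p] on all of them
   ([algebraic_average], [algebraic_dense]).  The agreement is exact, so that nothing
   is lost by passing to a closure, and an invariant convex set is stable under each
   of these averages.

   For an open set [C], a point [x] of [C] is replaced by a nearby algebraic point
   modulo [t] with the same projection ([open_convex_projection]).  For a set [C] of
   functionals, averages [m] of [l] in [C] agree with [l o p] on finite sets of
   algebraic vectors.  Those that agree with it at one algebraic point where [C] is
   bounded from above nearby form an equicontinuous family, so that they also
   approximate [l o p] on finite sets of arbitrary vectors; hence [l o p] is a weak-star
   limit of elements of [C] ([semi_equicontinuous_projection]).

   The analytic input is a calculus for smooth maps between locally convex spaces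
   that rests on a mean value theorem for convex open sets ([mean_value]): the
   derivative is linear, the chain rule holds and second derivatives are symmetric.
   The formula [d/ds Ad (exp (s h)) y = [h, y]] at [s = 0] then compares the bracket of
   left-invariant fields with the second derivative of conjugation in a chart
   ([has_dderive_Ad_exp]). *)

(** * The mean value theorem in locally convex spaces *)

Section Tvs.
Context {R : realType} {E : tvsType R}.

Lemma convex_combination (K : set E) (x y : E) (a : R) : convex_set K ->
  K x -> K y -> 0 <= a <= 1 -> K (a *: x + (1 - a) *: y).
Proof.
move=> cK Kx Ky a01; have aI : a \in `[0, 1] by rewrite in_itv.
by have := cK x y (Itv01 (andP a01).1 (andP a01).2) (mem_set Kx) (mem_set Ky); rewrite inE.
Qed.

Lemma nbhs_open_convex (x : E) (U : set E) : nbhs x U ->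
  exists K, [/\ open K, convex_set K, K x & K `<=` U].
Proof.
move=> xU; have [B cB [oB /(_ x U xU) [K [BK Kx] KU]]] := @locally_convex R E.
by exists K; split => //; [exact: oB|apply: cB; rewrite inE].
Qed.

Lemma cvg_add {T : Type} (F : set_system T) (f g : T -> E) (a b : E) :
  Filter F -> f x @[x --> F] --> a -> g x @[x --> F] --> b ->
  (f x + g x) @[x --> F] --> a + b.
Proof.
move=> FF fa gb.
exact: (cvg_comp (fun x => (f x, g x)) _ (cvg_pair fa gb) (@add_continuous E (a, b))).
Qed.

Lemma cvg_scale {T : Type} (F : set_system T) (k : T -> R) (f : T -> E) (r : R) (a : E) :
  Filter F -> k x @[x --> F] --> r -> f x @[x --> F] --> a ->
  (k x *: f x) @[x --> F] --> r *: a.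
Proof.
move=> FF kr fa.
exact: (cvg_comp (fun x => (k x : R^o, f x)) _ (cvg_pair kr fa)
  (@scale_continuous R E (r, a))).
Qed.

Lemma near0_dnbhs (P : R -> Prop) : (\forall h \near (0 : R)^', P h) ->
  exists2 d : R, 0 < d & forall h, h != 0 -> `|h| < d -> P h.
Proof.
move=> /nbhs_ballP[d /= d0 H]; exists d => // h h0 hd; apply: H => //.
by rewrite /ball /= sub0r normrN.
Qed.

Lemma dnbhs_near0 (P : R -> Prop) (d : R) : 0 < d ->
  (forall h, h != 0 -> `|h| < d -> P h) -> \forall h \near (0 : R)^', P h.
Proof.
move=> d0 H; apply/nbhs_ballP; exists d => //= h; rewrite /ball /= sub0r normrN.
by move=> hd h0; exact: H.
Qed.

End Tvs.

Section MeanValue.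
Context {R : realType} {E : tvsType R}.

(** The last [s] for which the difference quotient over [[a, s]] lies in [K] is [b].
   Indeed the quotient over two adjacent intervals is a convex combination of the
   quotients over each of them, and all quotients over short intervals with a given
   end point [s] lie in the neighbourhood [K] of the derivative at [s]. *)
Lemma mean_value_itv (g : R -> E) (K : set E) (a b : R) : a < b ->
  open K -> convex_set K ->
  (forall s, a <= s <= b -> exists2 l, K l &
    h^-1 *: (g (s + h) - g s) @[h --> (0 : R)^'] --> l) ->
  K ((b - a)^-1 *: (g b - g a)).
Proof.
move=> ab oK cK dg.
pose q s r := (r - s)^-1 *: (g r - g s).
have loc s : a <= s <= b -> exists2 d : R, 0 < d &
    forall r, r != s -> `|r - s| < d -> K (q s r).
  move=> /dg[l Kl gl]; have /near0_dnbhs[d d0 H] := gl _ (open_nbhs_nbhs (conj oK Kl)).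
  exists d => // r rs rd.
  have := H (r - s); rewrite subr_eq0 => /(_ rs rd).
  by rewrite /= (addrC s) subrK.
have glue s r u : s < r -> r < u -> K (q s r) -> K (q r u) -> K (q s u).
  move=> sr ru K1 K2.
  have -> : q s u = ((r - s) / (u - s)) *: q s r + (1 - (r - s) / (u - s)) *: q r u.
    have us : u - s != 0 by rewrite subr_eq0 gt_eqF// (lt_trans sr).
    have rs : r - s != 0 by rewrite subr_eq0 gt_eqF.
    have ur : u - r != 0 by rewrite subr_eq0 gt_eqF.
    rewrite /q !scalerA.
    have -> : (r - s) / (u - s) / (r - s) = (u - s)^-1 by field; apply/andP.
    have -> : (1 - (r - s) / (u - s)) / (u - r) = (u - s)^-1 by field; apply/andP.
    by rewrite -scalerDr [X in _ = _ *: X]addrC addrA subrK.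
  have us : 0 < u - s by rewrite subr_gt0 (lt_trans sr).
  apply: convex_combination => //; apply/andP; split.
    by rewrite divr_ge0// ?subr_ge0 ltW// (lt_trans sr).
  by rewrite ler_pdivrMr// mul1r lerD2r ltW.
have [d0 d0p K0] := loc a (introT andP (conj (lexx _) (ltW ab))).
pose S := [set s | a < s <= b /\ K (q a s)].
pose s0 := Num.min b (a + d0 / 2).
have as0 : a < s0 by rewrite /s0 lt_min ab ltrDl divr_gt0.
have Ss0 : S s0.
  split; first by rewrite as0 /s0 ge_min lexx.
  apply: K0; first by rewrite gt_eqF.
  have rle : s0 <= a + d0 / 2 by rewrite /s0 ge_min lexx orbT.
  by rewrite ger0_norm ?subr_ge0 ?ltW//; move: d0p rle; clearbody s0; lra.
have ubS : ubound S b by move=> s [/andP[]].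
have hS : has_sup S by split; [exists s0|exists b].
pose m := sup S.
have s0m : s0 <= m by apply: ub_le_sup => //; exists b.
have mb : m <= b by apply: ge_sup => //; exists s0.
have am : a < m by exact: lt_le_trans s0m.
have [d dp Kd] := loc m (introT andP (conj (ltW am) mb)).
have Sm : K (q a m).
  have [s [/andP[as_ sb] Ks] ms] := sup_adherent dp hS.
  have sm : s <= m by apply: ub_le_sup; [exists b|split => //; apply/andP].
  have [<-//|sm'] := eqVneq s m.
  apply: (glue _ s) => //; first by rewrite lt_neqAle sm'.
  have -> : q s m = q m s.
    by rewrite /q -[m - s]opprB -[g m - g s]opprB invrN scaleNr scalerN opprK.
  apply: Kd => //; rewrite ler0_norm ?subr_le0// opprB.
  by move: ms; rewrite -/m; lra.
have [<-//|mb'] := eqVneq m b.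
have mltb : m < b by rewrite lt_neqAle mb'.
pose r := Num.min b (m + d / 2).
have mr : m < r by rewrite /r lt_min mltb ltrDl divr_gt0.
have : S r.
  split; first by rewrite (lt_trans am mr) /r ge_min lexx.
  apply: (glue _ m) => //; apply: Kd; first by rewrite gt_eqF.
  have rle : r <= m + d / 2 by rewrite /r ge_min lexx orbT.
  by rewrite ger0_norm ?subr_ge0 ?ltW//; move: dp rle; clearbody r; lra.
by move=> Sr; have := ub_le_sup (ex_intro _ b ubS) Sr; rewrite leNgt mr.
Qed.

Lemma mean_value (D : tvsType R) (f : D -> E) (K : set E) (x v : D) (h : R) :
  h != 0 -> open K -> convex_set K ->
  (forall s, `|s| <= `|h| -> exists2 l, K l & has_dderive f (x + s *: v) v l) ->
  K (h^-1 *: (f (x + h *: v) - f x)).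
Proof.
move=> h0 oK cK df; pose g s := f (x + s *: v).
have dg s : `|s| <= `|h| -> exists2 l, K l &
    r^-1 *: (g (s + r) - g s) @[r --> (0 : R)^'] --> l.
  move=> /df[l Kl fl]; exists l => //; move: fl; rewrite /has_dderive /g.
  by under eq_fun do rewrite -addrA -scalerDl.
have [h0'|h0'|/eqP] := ltgtP h 0; last by rewrite (negbTE h0).
- have := @mean_value_itv g K h 0 h0' oK cK.
  rewrite /g scale0r addr0 sub0r invrN scaleNr -scalerN opprB; apply => s.
  by move=> /andP[hs s0]; apply: dg; rewrite !ler0_norm// ?lerN2// ltW.
- have := @mean_value_itv g K 0 h h0' oK cK.
  rewrite /g scale0r addr0 subr0; apply => s.
  by move=> /andP[hs s0]; apply: dg; rewrite !ger0_norm// ltW.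
Qed.

Lemma zero_derivative_constant (g : R -> E) : hausdorff_space E ->
  (forall s, h^-1 *: (g (s + h) - g s) @[h --> (0 : R)^'] --> (0 : E)) ->
  forall s, g s = g 0.
Proof.
move=> hE dg.
(* The quotients lie in every convex neighbourhood of 0, hence vanish. *)
have key a b : a < b -> g b = g a.
  move=> ab; set y := (b - a)^-1 *: (g b - g a).
  have y0 : y = 0.
    apply: hE => A B yA B0; have [K [oK cK K0 KB]] := nbhs_open_convex B0.
    exists y; split; first exact: nbhs_singleton.
    apply: KB; apply: (@mean_value_itv g K a b ab oK cK) => s _.
    by exists 0.
  have /eqP := y0; rewrite scaler_eq0 invr_eq0 subr_eq0 gt_eqF//= subr_eq0.
  by move/eqP.
by move=> s; have [/key//|/key//|->//] := ltgtP s 0.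
Qed.

End MeanValue.

(** * Directional derivatives *)

Section DirectionalDerivatives.
Context {R : realType}.
Implicit Types E F H : tvsType R.

Lemma cvg_line E (x v : E) : (x + h *: v) @[h --> (0 : R)^'] --> x.
Proof.
rewrite -[X in _ --> X]addr0 -(scale0r v); apply: cvg_add; first exact: cvg_cst.
apply: cvg_scale; last exact: cvg_cst.
exact: cvg_within.
Qed.

Lemma has_dderive_unique E F (f : E -> F) (x v : E) (l m : F) :
  hausdorff_space F -> has_dderive f x v l -> has_dderive f x v m -> l = m.
Proof. by move=> hF; exact: (@cvg_unique F hF). Qed.

Lemma dderiveE E F (f : E -> F) (x v : E) (l : F) :
  hausdorff_space F -> has_dderive f x v l -> dderive f x v = l.
Proof.
move=> hF fl; rewrite /dderive; case: xgetP => [m _ fm|/(_ l)//].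
exact: has_dderive_unique fm fl.
Qed.

Lemma eq_near_has_dderive E F (f g : E -> F) (x v : E) (l : F) :
  (\forall y \near x, f y = g y) -> has_dderive f x v l -> has_dderive g x v l.
Proof.
move=> fg; rewrite /has_dderive (nbhs_singleton fg) => fl.
apply: cvg_trans fl; apply: near_eq_cvg.
have := @cvg_line _ x v _ fg; rewrite nbhs_simpl /= => xg.
by apply: filterS xg => h /= ->.
Qed.

Lemma eq_near_dderive E F (f g : E -> F) (x : E) :
  (\forall y \near x, f y = g y) -> dderive f x = dderive g x.
Proof.
move=> fg; apply/funext => v; congr xget; apply/funext => l; apply/propext.
split; apply: eq_near_has_dderive => //.
by apply: filterS fg.
Qed.

Lemma has_dderive0 E F (f : E -> F) (x : E) : has_dderive f x 0 0.
Proof.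
rewrite /has_dderive; under eq_fun do rewrite scaler0 addr0 subrr scaler0.
exact: cvg_cst.
Qed.

Lemma has_dderiveZ E F (f : E -> F) (x v : E) (l : F) (a : R) :
  has_dderive f x v l -> has_dderive f x (a *: v) (a *: l).
Proof.
have [->|a0] := eqVneq a 0; first by rewrite !scale0r => _; exact: has_dderive0.
move=> fl; rewrite /has_dderive.
have ha : (h * a) @[h --> (0 : R)^'] --> (0 : R)^'.
  move=> A /near0_dnbhs[d d0 H].
  apply: (@dnbhs_near0 _ _ (d / `|a|)) => [|h h0 hd]; first by rewrite divr_gt0 ?normr_gt0.
  by apply: H; [rewrite mulf_neq0|rewrite normrM -ltr_pdivlMr ?normr_gt0].
have c : a *: ((h * a)^-1 *: (f (x + (h * a) *: v) - f x)) @[h --> (0 : R)^'] --> a *: l.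
  by apply: cvg_scale; [exact: cvg_cst|exact: cvg_comp ha fl].
apply: cvg_trans c; apply: near_eq_cvg; near=> h.
have h0 : h != 0 by near: h; exact: nbhs_dnbhs_neq.
by rewrite /= !scalerA invfM mulrCA mulfV// mulr1.
Unshelve. all: by end_near. Qed.

Lemma has_dderive_cst E F (a : F) (x v : E) : has_dderive (fun=> a) x v 0.
Proof.
by rewrite /has_dderive; under eq_fun do rewrite subrr scaler0; exact: cvg_cst.
Qed.

Lemma has_dderive_linear E F (f : E -> F) (x v : E) :
  (forall (a : R) y z, f (a *: y + z) = a *: f y + f z) -> has_dderive f x v (f v).
Proof.
move=> lf; apply: (@cvg_trans _ (cst (f v) @ (0 : R)^')); last exact: cvg_cst.
apply: near_eq_cvg; near=> h; have h0 : h != 0 by near: h; exact: nbhs_dnbhs_neq.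
by rewrite /= (addrC x) lf addrK scalerA mulVf// scale1r.
Unshelve. all: by end_near. Qed.

Lemma has_dderive_pair E F H (f : E -> F) (g : E -> H) (x v : E) (l : F) (m : H) :
  has_dderive f x v l -> has_dderive g x v m ->
  has_dderive (fun y => (f y, g y)) x v (l, m).
Proof. by move=> fl gm; exact: cvg_pair fl gm. Qed.

Lemma has_dderive_sub E F (f g : E -> F) (x v : E) (l m : F) :
  has_dderive f x v l -> has_dderive g x v m ->
  has_dderive (fun y => f y - g y) x v (l - m).
Proof.
move=> fl gm; rewrite -(scaleN1r m).
have c : (h^-1 *: (f (x + h *: v) - f x) + (-1) *: (h^-1 *: (g (x + h *: v) - g x)))
    @[h --> (0 : R)^'] --> l + (-1) *: m.
  by apply: cvg_add => //; apply: cvg_scale => //; exact: cvg_cst.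
apply: cvg_trans c; apply: near_eq_cvg; apply: nearW => h /=.
by rewrite scaleN1r -scalerBr !opprB addrACA [in RHS]addrACA (addrC (- f x)).
Qed.

Lemma has_dderive_scale E F (f : E -> F) (x v : E) (l : F) (a : R) :
  has_dderive f x v l -> has_dderive (fun y => a *: f y) x v (a *: l).
Proof.
move=> fl; rewrite /has_dderive.
under eq_fun do rewrite -scalerBr scalerA mulrC -scalerA.
by apply: cvg_scale => //; exact: cvg_cst.
Qed.

Lemma has_dderive_shift E F (f : E -> F) (x v u : E) (l : F) :
  has_dderive f (x + u) v l -> has_dderive (fun y => f (y + u)) x v l.
Proof. by rewrite /has_dderive; under eq_fun do rewrite addrAC. Qed.

(** Difference quotients converge to the derivative even when the base point and
   the direction move: the mean value theorem bounds them by the values of the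
   continuous map [df] nearby.  Additivity of the derivative, the chain rule and
   the symmetry of second derivatives all rest on this. *)
Lemma strict_derivative E F (U : set E) (f : E -> F) (df : E * E -> F) (x v : E)
    (K : set F) :
  open U -> (forall y w, U y -> has_dderive f y w (df (y, w))) -> U x ->
  {for (x, v), continuous df} -> open K -> convex_set K -> K (df (x, v)) ->
  exists2 d : R, 0 < d & \forall z \near (x, v), forall h, h != 0 -> `|h| < d ->
    K (h^-1 *: (f (z.1 + h *: z.2) - f z.1)).
Proof.
move=> oU dfU Ux cdf oK cK Kx.
have nN : \forall z \near (x, v), U z.1 /\ K (df z).
  apply: filterI; last by apply: cdf; exact: open_nbhs_nbhs.
  by apply: cvg_fst; exact: open_nbhs_nbhs.
have cphi : ((y.2.1 + y.1 *: y.2.2, y.2.2) : E * E)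
    @[y --> ((0 : R^o), (x, v))] --> (x, v).
  have c2 : y.2 @[y --> ((0 : R^o), (x, v))] --> (x, v) by exact: cvg_snd.
  have c21 : y.2.1 @[y --> ((0 : R^o), (x, v))] --> x.
    by apply: (cvg_comp _ _ c2); exact: cvg_fst.
  have c22 : y.2.2 @[y --> ((0 : R^o), (x, v))] --> v.
    by apply: (cvg_comp _ _ c2); exact: cvg_snd.
  have c1 : y.2.1 + y.1 *: y.2.2 @[y --> ((0 : R^o), (x, v))] --> x + (0 : R) *: v.
    by apply: cvg_add => //; apply: cvg_scale => //; exact: cvg_fst.
  by rewrite scale0r addr0 in c1; exact: cvg_pair c1 c22.
have [[A B] [/= /nbhs_ballP[d /= d0 dA] nB] AB] := cphi _ nN.
exists d => //; apply: filterS nB => -[y w] Byw h h0 hd.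
apply: (@mean_value R F E f K y w h h0 oK cK) => s sh; exists (df (y + s *: w, w)).
  apply: (AB (s, (y, w)) _).2; split => //; apply: dA.
  by rewrite /ball /= sub0r normrN (le_lt_trans sh).
apply: dfU; apply: (AB (s, (y, w)) _).1; split => //; apply: dA.
by rewrite /ball /= sub0r normrN (le_lt_trans sh).
Qed.

Lemma has_dderive_comp E F H (f : E -> F) (V : set F) (g : F -> H) (dg : F * F -> H)
    (x v : E) (l : F) :
  has_dderive f x v l -> open V -> V (f x) ->
  (forall y w, V y -> has_dderive g y w (dg (y, w))) ->
  {for (f x, l), continuous dg} ->
  has_dderive (g \o f) x v (dg (f x, l)).
Proof.
move=> fl oV Vfx dgV cdg A nA; have [K [oK cK Kl KA]] := nbhs_open_convex nA.
have [d d0 nz] := strict_derivative oV dgV Vfx cdg oK cK Kl.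
have c : (f x, h^-1 *: (f (x + h *: v) - f x)) @[h --> (0 : R)^'] --> (f x, l).
  by apply: cvg_pair fl; exact: cvg_cst.
have nh := c _ nz; rewrite nbhs_simpl /= in nh.
change (\forall h \near (0 : R)^', A (h^-1 *: ((g \o f) (x + h *: v) - (g \o f) x))).
near=> h; apply: KA.
have h0 : h != 0 by near: h; exact: nbhs_dnbhs_neq.
have hd : `|h| < d by near: h; exact: dnbhs0_lt.
have /= := (near nh h _) h h0 hd.
by rewrite scalerA mulfV// scale1r (addrC (f x)) subrK; apply.
Unshelve. all: by end_near. Qed.

Lemma has_dderiveD E F (U : set E) (f : E -> F) (df : E * E -> F) (x v w : E) :
  open U -> U x -> (forall y w, U y -> has_dderive f y w (df (y, w))) ->
  {for (x, w), continuous df} ->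
  has_dderive f x (v + w) (df (x, v) + df (x, w)).
Proof.
move=> oU Ux dfU cdf.
have qw : h^-1 *: (f (x + h *: v + h *: w) - f (x + h *: v)) @[h --> (0 : R)^']
    --> df (x, w).
  move=> A nA; have [K [oK cK Kl KA]] := nbhs_open_convex nA.
  have [d d0 nz] := strict_derivative oU dfU Ux cdf oK cK Kl.
  have c : (x + h *: v, w) @[h --> (0 : R)^'] --> (x, w).
    by apply: cvg_pair; [exact: cvg_line|exact: cvg_cst].
  have nh := c _ nz; rewrite nbhs_simpl /= in nh.
  change (\forall h \near (0 : R)^',
    A (h^-1 *: (f (x + h *: v + h *: w) - f (x + h *: v)))).
  near=> h; apply: KA.
  have h0 : h != 0 by near: h; exact: nbhs_dnbhs_neq.
  have hd : `|h| < d by near: h; exact: dnbhs0_lt.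
  by have /= := (near nh h _) h h0 hd; apply.
have c : (h^-1 *: (f (x + h *: v + h *: w) - f (x + h *: v)) +
    h^-1 *: (f (x + h *: v) - f x)) @[h --> (0 : R)^'] --> df (x, w) + df (x, v).
  by apply: cvg_add qw _; exact: dfU.
rewrite [df _ + _]addrC; apply: cvg_trans c; apply: near_eq_cvg; apply: nearW => h /=.
by rewrite -scalerDr addrA subrK (scalerDr h) addrA.
Unshelve. all: by end_near. Qed.

(** Schwarz: the second difference of [f] in the directions [v] and [w] over [h]
   and [k] lies, by the mean value theorem, in any convex neighbourhood of the
   value at [x] of the derivative of [df (-, w)] in direction [v]; letting [k] tend
   to 0 first gives the derivative in the other order. *)
Lemma has_dderive_swap E F (U : set E) (f : E -> F) (df : E * E -> F)
    (ddf : E * E -> F) (x v w : E) :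
  open U -> U x -> (forall y u, U y -> has_dderive f y u (df (y, u))) ->
  (forall y u, U y -> has_dderive (fun y => df (y, w)) y u (ddf (y, u))) ->
  {for (x, v), continuous ddf} ->
  has_dderive (fun y => df (y, v)) x w (ddf (x, v)).
Proof.
move=> oU Ux dfU ddfU cddf A.
(* The limit over [k] stays in the closure of a convex set, hence the detour
   through a closed neighbourhood. *)
move=> /uniform_regular[B nB BA]; have [K [oK cK Kl KB]] := nbhs_open_convex nB.
have [d d0 nz] := strict_derivative oU ddfU Ux cddf oK cK Kl.
have cphi : ((x + y.1 *: w + y.2 *: v) : E) @[y --> ((0 : R^o), (0 : R^o))] --> x.
  have c : ((x + y.1 *: w + y.2 *: v) : E) @[y --> ((0 : R^o), (0 : R^o))] -->
      x + (0 : R) *: w + (0 : R) *: v.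
    apply: cvg_add; last by apply: cvg_scale; [exact: cvg_snd|exact: cvg_cst].
    apply: cvg_add; first exact: cvg_cst.
    by apply: cvg_scale; [exact: cvg_fst|exact: cvg_cst].
  by rewrite !scale0r !addr0 in c.
have nW : \forall y \near x, U y /\ forall h, h != 0 -> `|h| < d ->
    K (h^-1 *: (df (y + h *: v, w) - df (y, w))).
  apply: filterI; first exact: open_nbhs_nbhs.
  have c : (y, v) @[y --> x] --> (x, v) by apply: cvg_pair; [exact: cvg_id|exact: cvg_cst].
  by have := c _ nz; rewrite nbhs_simpl.
have [[A1 B1] [/= /nbhs_ballP[a /= a0 aA] /nbhs_ballP[b /= b0 bB]] AB] := cphi _ nW.
change (\forall h \near (0 : R)^', A (h^-1 *: (df (x + h *: w, v) - df (x, v)))).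
near=> h; apply: BA.
have h0 : h != 0 by near: h; exact: nbhs_dnbhs_neq.
have ha : `|h| < a by near: h; exact: dnbhs0_lt.
have W s k : `|s| <= `|h| -> `|k| < b -> U (x + s *: w + k *: v) /\
    forall h, h != 0 -> `|h| < d ->
    K (h^-1 *: (df (x + s *: w + k *: v + h *: v, w) - df (x + s *: w + k *: v, w))).
  move=> sh kb; apply: (AB (s, k)); split; [apply: aA|apply: bB].
    by rewrite /ball /= sub0r normrN (le_lt_trans sh).
  by rewrite /ball /= sub0r normrN.
have W0 s : `|s| <= `|h| -> U (x + s *: w) /\
    forall h, h != 0 -> `|h| < d ->
    K (h^-1 *: (df (x + s *: w + h *: v, w) - df (x + s *: w, w))).
  by move=> /(W _ 0); rewrite scale0r addr0 normr0; exact.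
pose q k := h^-1 *: (k^-1 *: (f (x + h *: w + k *: v) - f (x + h *: w)) -
                     k^-1 *: (f (x + k *: v) - f x)).
have qK : \forall k \near (0 : R)^', B (q k).
  near=> k; have k0 : k != 0 by near: k; exact: nbhs_dnbhs_neq.
  have kb : `|k| < b by near: k; exact: dnbhs0_lt.
  have kd : `|k| < d by near: k; exact: dnbhs0_lt.
  pose g y := k^-1 *: (f (y + k *: v) - f y).
  have -> : q k = h^-1 *: (g (x + h *: w) - g x) by [].
  apply: KB; apply: (@mean_value R F E g K x w h h0 oK cK) => s sh.
  exists (k^-1 *: (df (x + s *: w + k *: v, w) - df (x + s *: w, w))).
    by apply: (W0 s sh).2.
  apply: has_dderive_scale; apply: has_dderive_sub; last exact: dfU (W0 s sh).1.
  by apply: has_dderive_shift; exact: dfU (W s k sh kb).1.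
have qc : q k @[k --> (0 : R)^'] --> h^-1 *: (df (x + h *: w, v) - df (x, v)).
  apply: cvg_scale; first exact: cvg_cst.
  have := dfU _ v (W0 h (lexx _)).1; rewrite /has_dderive => d1.
  have d2 := dfU _ v Ux.
  rewrite -(scaleN1r (df (x, v))).
  under eq_fun do rewrite -(scaleN1r (_ *: _)).
  by apply: cvg_add => //; apply: cvg_scale => //; exact: cvg_cst.
apply: (closed_cvg _ (@closed_closure _ B) _ _ qc).
by apply: filterS qK => k; exact: subset_closure.
Unshelve. all: by end_near. Qed.

End DirectionalDerivatives.

(** * Smooth maps *)

Section ClassC.
Context {R : realType}.
Implicit Types E F H : tvsType R.

Lemma open_setX (S T : topologicalType) (A : set S) (B : set T) :
  open A -> open B -> open (A `*` B).
Proof.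
move=> oA oB; rewrite openE => -[x y] [/= Ax By].
by exists (A, B) => //; split; exact: open_nbhs_nbhs.
Qed.

Lemma open_within_continuous (S T : topologicalType) (U : set S) (f : S -> T) :
  open U -> {within U, continuous f} <-> (forall x, U x -> {for x, continuous f}).
Proof.
move=> oU; rewrite continuous_open_subspace//.
by split=> cf x Ux; apply: cf; rewrite inE in Ux *.
Qed.

Lemma class_C_continuous k E F (U : set E) (f : E -> F) (x : E) :
  open U -> class_C k U f -> U x -> {for x, continuous f}.
Proof.
by move=> oU; case: k => [|k] [/(open_within_continuous _ oU) cf _] Ux; exact: cf.
Qed.

Lemma class_C_subset k E F (U V : set E) (f : E -> F) :
  V `<=` U -> class_C k U f -> class_C k V f.
Proof.
elim: k E U V f => [|k IHk] E U V f VU [cf].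
  by split=> //; exact: continuous_subspaceW cf.
move=> [df dfU Cdf]; split; first exact: continuous_subspaceW cf.
exists df => [x v Vx|]; first by apply: dfU; exact: VU.
by apply: IHk Cdf => -[x v] [/= Vx _]; split => //; exact: VU.
Qed.

Lemma class_CW k E F (U : set E) (f : E -> F) : class_C k.+1 U f -> class_C k U f.
Proof.
elim: k E U f => [|k IHk] E U f [cf [df dfU Cdf]]; first by split.
by split=> //; exists df => //; exact: IHk.
Qed.

Lemma eq_class_C k E F (U : set E) (f g : E -> F) : open U ->
  (forall x, U x -> f x = g x) -> class_C k U f -> class_C k U g.
Proof.
move=> oU fg.
have fgn x : U x -> \forall y \near x, f y = g y.
  by move=> Ux; apply: filterS fg _; exact: open_nbhs_nbhs.
have cg : {within U, continuous f} -> {within U, continuous g}.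
  move=> /(open_within_continuous _ oU) cf.
  apply/(open_within_continuous _ oU) => x Ux.
  have gx : g @ x --> f x.
    by apply: cvg_trans (cf x Ux); apply: near_eq_cvg; exact: fgn.
  by rewrite fg in gx.
case: k => [|k] [/cg cg' df]; split => //; move: df => [df dfU Cdf].
by exists df => // x v Ux; apply: eq_near_has_dderive (dfU x v Ux); exact: fgn.
Qed.

Lemma class_C_linear k E F (U : set E) (f : E -> F) : continuous f ->
  (forall (a : R) y z, f (a *: y + z) = a *: f y + f z) -> class_C k U f.
Proof.
elim: k E U f => [|k IHk] E U f cf lf; split => //; try exact: continuous_subspaceT.
exists (fun z => f z.2) => [x v _|]; first exact: has_dderive_linear.
apply: IHk => [z|a y z]; last exact: lf.
by apply: (@continuous_comp _ _ _ snd f); [exact: cvg_snd|exact: cf].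
Qed.

Lemma class_C_cst k E F (U : set E) (a : F) : class_C k U (fun=> a).
Proof.
case: k => [|k]; split; try by apply: continuous_subspaceT => x; exact: cvg_cst.
  by [].
exists (fun=> 0) => [x v _|]; first exact: has_dderive_cst.
apply: class_C_linear => [x|b y z]; first exact: cvg_cst.
by rewrite scaler0 addr0.
Qed.

Lemma class_C_pair k E F H (U : set E) (f : E -> F) (g : E -> H) : open U ->
  class_C k U f -> class_C k U g -> class_C k U (fun x => (f x, g x)).
Proof.
elim: k E U f g => [|k IHk] E U f g oU [cf df] [cg dg]; split=> //; first last.
- move: df dg => [df dfU Cdf] [dg dgU Cdg].
  exists (fun z => (df z, dg z)) => [x v Ux|].
    by apply: has_dderive_pair; [exact: dfU|exact: dgU].
  by apply: IHk => //; apply: open_setX => //; exact: openT.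
- move/(open_within_continuous _ oU): cf => cf.
  move/(open_within_continuous _ oU): cg => cg.
  by apply/(open_within_continuous _ oU) => x Ux; exact: cvg_pair (cf x Ux) (cg x Ux).
- move/(open_within_continuous _ oU): cf => cf.
  move/(open_within_continuous _ oU): cg => cg.
  by apply/(open_within_continuous _ oU) => x Ux; exact: cvg_pair (cf x Ux) (cg x Ux).
Qed.

(** Induction on the degree: the derivative [(x, v) |-> dg (f x, df (x, v))] is a
   composite of maps that are one degree less smooth. *)
Lemma class_C_comp k E F H (U : set E) (V : set F) (f : E -> F) (g : F -> H) :
  open U -> open V -> (forall x, U x -> V (f x)) ->
  class_C k U f -> class_C k V g -> class_C k U (g \o f).
Proof.
elim: k E F H U V f g => [|k IHk] E F H U V f g oU oV UV Cf Cg.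
  split=> //; apply/(open_within_continuous _ oU) => x Ux.
  apply: continuous_comp; first exact: class_C_continuous Cf Ux.
  exact: class_C_continuous Cg (UV x Ux).
split.
  apply/(open_within_continuous _ oU) => x Ux.
  apply: continuous_comp; first exact: class_C_continuous Cf Ux.
  exact: class_C_continuous Cg (UV x Ux).
have Cf' := class_CW Cf; move: Cf Cg => [_ [df dfU Cdf]] [_ [dg dgV Cdg]].
have oUT : open (U `*` [set: E]) by apply: open_setX => //; exact: openT.
have oVT : open (V `*` [set: F]) by apply: open_setX => //; exact: openT.
exists (dg \o (fun z : E * E => (f z.1, df z))) => [x v Ux|].
  apply: has_dderive_comp (dfU x v Ux) oV (UV x Ux) dgV _.
  by apply: class_C_continuous Cdg _ => //; split => //; exact: UV.
apply: (IHk _ _ _ _ (V `*` setT)) => // [[x v] [/= Ux _]|]; first by split=> //; exact: UV.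
apply: class_C_pair => //; apply: (IHk _ _ _ _ U fst f) => // [[x v] []//|].
by apply: class_C_linear => // x; exact: cvg_fst.
Qed.

End ClassC.

(** Smoothness on some neighbourhood: the domains on which the charts express the
   group operations never matter. *)
Definition smooth_near (R : realType) (E F : tvsType R) (f : E -> F) (x : E) :=
  exists U, [/\ open U, U x & smooth_on U f].

Section SmoothNear.
Context {R : realType}.
Implicit Types E F H : tvsType R.

Lemma smooth_near_continuous E F (f : E -> F) (x : E) :
  smooth_near f x -> {for x, continuous f}.
Proof. by move=> [U [oU Ux sf]]; exact: class_C_continuous (sf 0) Ux. Qed.

Lemma eq_smooth_near E F (f g : E -> F) (x : E) :
  (\forall y \near x, f y = g y) -> smooth_near f x -> smooth_near g x.
Proof.
move=> fg; have : nbhs x [set y | f y = g y] by exact: fg.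
rewrite nbhsE => -[V [oV Vx] VE] [U [oU Ux sf]].
exists (U `&` V); split => [||k]; [exact: openI|by []|].
apply: (@eq_class_C _ _ _ _ _ f); first exact: openI.
  by move=> y [_ /VE].
by apply: class_C_subset (sf k); exact: subIsetl.
Qed.

Lemma smooth_near_linear E F (f : E -> F) (x : E) : continuous f ->
  (forall (a : R) y z, f (a *: y + z) = a *: f y + f z) -> smooth_near f x.
Proof.
by move=> cf lf; exists setT; split => // [|k]; [exact: openT|exact: class_C_linear].
Qed.

Lemma smooth_near_cst E F (a : F) (x : E) : smooth_near (fun=> a) x.
Proof. by exists setT; split => // [|k]; [exact: openT|exact: class_C_cst]. Qed.

Lemma smooth_near_id E (x : E) : smooth_near (fun y : E => y) x.
Proof. by apply: smooth_near_linear => // y; exact: cvg_id. Qed.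

Lemma smooth_near_pair E F H (f : E -> F) (g : E -> H) (x : E) :
  smooth_near f x -> smooth_near g x -> smooth_near (fun y => (f y, g y)) x.
Proof.
move=> [U [oU Ux sf]] [V [oV Vx sg]]; exists (U `&` V).
split => [||k]; [exact: openI|by []|].
apply: class_C_pair; first exact: openI.
  by apply: class_C_subset (sf k); exact: subIsetl.
by apply: class_C_subset (sg k); exact: subIsetr.
Qed.

Lemma smooth_near_comp E F H (f : E -> F) (g : F -> H) (x : E) :
  smooth_near f x -> smooth_near g (f x) -> smooth_near (fun y => g (f y)) x.
Proof.
move=> [U [oU Ux sf]] [V [oV Vx sg]].
have oW : open (U `&` f @^-1` V).
  rewrite openE => y [Uy Vfy]; apply: filterI; first exact: open_nbhs_nbhs.
  by apply: (class_C_continuous oU (sf 0) Uy); exact: open_nbhs_nbhs.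
exists (U `&` f @^-1` V); split => // k.
apply: (@class_C_comp _ _ _ _ _ _ V) (sg k) => // [y []//|].
by apply: class_C_subset (sf k); exact: subIsetl.
Qed.

Lemma smooth_near_fst E F H (f : E -> F * H) (x : E) :
  smooth_near f x -> smooth_near (fun y => (f y).1) x.
Proof.
move=> sf; apply: smooth_near_comp sf _.
by apply: smooth_near_linear => // y; exact: cvg_fst.
Qed.

Lemma smooth_near_snd E F H (f : E -> F * H) (x : E) :
  smooth_near f x -> smooth_near (fun y => (f y).2) x.
Proof.
move=> sf; apply: smooth_near_comp sf _.
by apply: smooth_near_linear => // y; exact: cvg_snd.
Qed.

(** Uniqueness of limits makes [dderive f] the derivative that witnesses every
   degree of differentiability at once. *)
Lemma smooth_near_dderive E F (f : E -> F) (x : E) : hausdorff_space F ->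
  smooth_near f x -> exists U, [/\ open U, U x,
    (forall y v, U y -> has_dderive f y v (dderive f y v)) &
    smooth_on (U `*` setT) (fun z : E * E => dderive f z.1 z.2)].
Proof.
move=> hF [U [oU Ux sf]]; exists U; split=> // [y v Uy|k].
  by have [_ [df /(_ y v Uy) fl _]] := sf 1; rewrite (dderiveE hF fl).
have [_ [df dfU Cdf]] := sf k.+1.
apply: eq_class_C Cdf => [|[y v] [/= Uy _]].
  by apply: open_setX => //; exact: openT.
by apply/esym/(dderiveE hF); exact: dfU.
Qed.

Section Hausdorff.
Context {F : tvsType R} (hF : hausdorff_space F).

Lemma smooth_near_has_dderive E (f : E -> F) (x v : E) :
  smooth_near f x -> has_dderive f x v (dderive f x v).
Proof. by move=> /(smooth_near_dderive hF)[U [_ Ux dfU _]]; exact: dfU. Qed.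

Lemma smooth_near_dderive2 E (f : E -> F) (x v : E) :
  smooth_near f x -> smooth_near (fun z : E * E => dderive f z.1 z.2) (x, v).
Proof.
move=> /(smooth_near_dderive hF)[U [oU Ux _ sf]]; exists (U `*` setT).
by split=> //; apply: open_setX => //; exact: openT.
Qed.

Lemma smooth_near_dderive1 E (f : E -> F) (x v : E) :
  smooth_near f x -> smooth_near (fun y => dderive f y v) x.
Proof.
move=> /smooth_near_dderive2 sf.
apply: (smooth_near_comp (f := fun y => (y, v)) _ (sf v)).
by apply: smooth_near_pair; [exact: smooth_near_id|exact: smooth_near_cst].
Qed.

Lemma dderiveZ E (f : E -> F) (x v : E) (a : R) :
  smooth_near f x -> dderive f x (a *: v) = a *: dderive f x v.
Proof.
by move=> sf; apply: (dderiveE hF); apply: has_dderiveZ; exact: smooth_near_has_dderive.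
Qed.

Lemma dderiveD E (f : E -> F) (x v w : E) :
  smooth_near f x -> dderive f x (v + w) = dderive f x v + dderive f x w.
Proof.
move=> sf; have [U [oU Ux dfU _]] := smooth_near_dderive hF sf; apply: (dderiveE hF).
have := @has_dderiveD _ _ _ U f (fun z => dderive f z.1 z.2) x v w oU Ux dfU.
by apply; exact: smooth_near_continuous (smooth_near_dderive2 w sf).
Qed.

Lemma dderive_continuous E (f : E -> F) (x : E) :
  smooth_near f x -> continuous (dderive f x).
Proof.
move=> sf v; have c := smooth_near_continuous (smooth_near_dderive2 v sf).
apply: (@continuous_comp _ _ _ (fun v => (x, v))) c.
by apply: cvg_pair; [exact: cvg_cst|exact: cvg_id].
Qed.

Lemma has_dderive_comp_near (D : tvsType R) E (f : D -> E) (g : E -> F) (x v : D) (l : E) :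
  has_dderive f x v l -> smooth_near g (f x) ->
  has_dderive (fun y => g (f y)) x v (dderive g (f x) l).
Proof.
move=> fl sg; have [V [oV Vx dgV _]] := smooth_near_dderive hF sg.
have := @has_dderive_comp _ _ _ _ f V g (fun z => dderive g z.1 z.2) x v l fl oV Vx dgV.
by apply; exact: smooth_near_continuous (smooth_near_dderive2 l sg).
Qed.

Lemma dderive_comp (D : tvsType R) E (f : D -> E) (g : E -> F) (x v : D) (l : E) :
  has_dderive f x v l -> smooth_near g (f x) ->
  dderive (fun y => g (f y)) x v = dderive g (f x) l.
Proof. by move=> fl sg; apply: (dderiveE hF); exact: has_dderive_comp_near. Qed.

Lemma dderive_swap E (f : E -> F) (x v w : E) : smooth_near f x ->
  dderive (fun y => dderive f y v) x w = dderive (fun y => dderive f y w) x v.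
Proof.
move=> sf; apply: (dderiveE hF).
have [U [oU Ux dfU _]] := smooth_near_dderive hF sf.
have [V [oV Vx dgV _]] := smooth_near_dderive hF (smooth_near_dderive1 w sf).
have oW : open (U `&` V) by exact: openI.
have dfW y u : (U `&` V) y -> has_dderive f y u (dderive f y u).
  by move=> [Uy _]; exact: dfU.
have dgW y u : (U `&` V) y ->
    has_dderive (fun y => dderive f y w) y u (dderive (fun y => dderive f y w) y u).
  by move=> [_ Vy]; exact: dgV.
have c := smooth_near_continuous (smooth_near_dderive2 v (smooth_near_dderive1 w sf)).
exact: (@has_dderive_swap _ _ _ (U `&` V) f (fun z => dderive f z.1 z.2)
  (fun z => dderive (fun y => dderive f y w) z.1 z.2) x v w oW (conj Ux Vx) dfW dgW c).
Qed.

End Hausdorff.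

(** A partial derivative is the derivative of the partial function: both are
   limits of the same difference quotients, whatever the smoothness. *)
Lemma dderive_partial1 E F H (f : E * F -> H) (x v : E) (y : F) :
  dderive f (x, y) (v, 0) = dderive (fun x => f (x, y)) x v.
Proof.
rewrite /dderive /has_dderive.
have -> : (fun h => h^-1 *: (f ((x, y) + h *: (v, 0)) - f (x, y))) =
          (fun h => h^-1 *: (f (x + h *: v, y) - f (x, y))); last by [].
apply/funext => h; congr (_ *: (f _ - _)).
by apply: injective_projections => //=; rewrite scaler0 addr0.
Qed.

Lemma dderive_partial2 E F H (f : E * F -> H) (x : E) (y w : F) :
  dderive f (x, y) (0, w) = dderive (fun y => f (x, y)) y w.
Proof.
rewrite /dderive /has_dderive.
have -> : (fun h => h^-1 *: (f ((x, y) + h *: (0, w)) - f (x, y))) =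
          (fun h => h^-1 *: (f (x, y + h *: w) - f (x, y))); last by [].
apply/funext => h; congr (_ *: (f _ - _)).
by apply: injective_projections => //=; rewrite scaler0 addr0.
Qed.

End SmoothNear.

(** * The adjoint action of a Lie group *)

Section Charts.
Context {R : realType}.

Lemma chart_inv_continuous_at (E : tvsType R) (M : topologicalType) (c : chart E M)
    (x : M) : chart_dom c x -> chart_inv c a @[a --> chart_fun c x] --> x.
Proof.
move=> cx.
have /(open_within_continuous _ (chart_img_open c)) := @chart_inv_continuous _ _ _ c.
move=> /(_ (chart_fun c x) (ex_intro2 _ _ x cx erefl)) cpsi.
by rewrite -[X in _ --> X](chart_funK cx).
Qed.

Lemma smooth_map_near (E F : tvsType R) (M N : topologicalType)
    (A : set (chart E M)) (B : set (chart F N)) (f : M -> N) c d (x : M) :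
  smooth_map A B f -> A c -> B d -> chart_dom c x -> chart_dom d (f x) ->
  smooth_near (fun a => chart_fun d (f (chart_inv c a))) (chart_fun c x).
Proof.
move=> [cf sf] Ac Bd cx dfx.
exists (chart_img c `&` [set a | chart_dom d (f (chart_inv c a))]); split.
- rewrite openE => a [[y cy <-]]; rewrite /= chart_funK// => dfy.
  apply: filterI.
    by apply: open_nbhs_nbhs; split; [exact: chart_img_open|exists y].
  have cfi : f (chart_inv c a) @[a --> chart_fun c y] --> f y.
    exact: cvg_comp (chart_inv_continuous_at cy) (cf y).
  by apply: cfi; apply: open_nbhs_nbhs; split; [exact: chart_dom_open|].
- by split; [exists x|rewrite /= chart_funK].
- exact: sf.
Qed.

End Charts.

Section LieGroup.
Context {R : realType} {E : tvsType R} {G : lieGroupType E}.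
Variable c : chart E G.
Hypotheses (hE : hausdorff_space E) (hc : chart_at_one c).

Let e := chart_fun c 1%g.
Local Notation "'phi'" := (chart_fun c).
Local Notation psi := (chart_inv c).

Lemma mulg_continuous : continuous (fun z : G * G => (z.1 * z.2)%g).
Proof. exact: (@lie_mul_smooth R E G).1. Qed.

Lemma cvg_mulg {T : Type} (F : set_system T) (f g : T -> G) (a b : G) : Filter F ->
  f x @[x --> F] --> a -> g x @[x --> F] --> b -> (f x * g x)%g @[x --> F] --> (a * b)%g.
Proof.
move=> FF fa gb.
exact: (cvg_comp (fun x => (f x, g x)) _ (cvg_pair fa gb) (@mulg_continuous (a, b))).
Qed.

Lemma cvg_chart_inv1 : psi a @[a --> e] --> (1 : G)%g.
Proof. by apply: chart_inv_continuous_at; exact: hc.2. Qed.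

Lemma near_chart_dom (T : topologicalType) (f : T -> G) (x : T) (d : chart E G) (g : G) :
  f y @[y --> x] --> g -> chart_dom d g -> \forall y \near x, chart_dom d (f y).
Proof.
by move=> fx dg; apply: fx; apply: open_nbhs_nbhs; split => //; exact: chart_dom_open.
Qed.

Lemma mul_smooth_near (c1 c2 c3 : chart E G) (g1 g2 : G) :
  lie_atlas c1 -> lie_atlas c2 -> lie_atlas c3 ->
  chart_dom c1 g1 -> chart_dom c2 g2 -> chart_dom c3 (g1 * g2)%g ->
  smooth_near (fun z : E * E => chart_fun c3 (chart_inv c1 z.1 * chart_inv c2 z.2)%g)
    (chart_fun c1 g1, chart_fun c2 g2).
Proof.
move=> A1 A2 A3 d1 d2 d3.
apply: (@smooth_map_near _ _ _ _ _ _ _ _ (prod_chart c1 c2) c3 (g1, g2)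
  lie_mul_smooth) => //.
by exists c1, c2.
Qed.

(** Conjugation by [g] near 1 factors through a chart around [g]: translate on the
   left by [g], then on the right by its inverse. *)
Lemma conj_smooth_near (g : G) : smooth_near (fun a => phi (g * psi a * g^-1)%g) e.
Proof.
have [Ac c1] := hc.
have [d Ad dg] := @lie_atlas_cover R E G g.
have [d' Ad' dg'] := @lie_atlas_cover R E G g^-1%g.
have s1 : smooth_near (fun a => chart_fun d (g * psi a)%g) e.
  have := @mul_smooth_near d c d g 1%g Ad Ac Ad dg c1.
  rewrite mulg1 => /(_ dg) s.
  have := @smooth_near_comp _ _ _ _ (fun a : E => (chart_fun d g, a)) _ e _ s.
  rewrite /= chart_funK//; apply.
  by apply: smooth_near_pair; [exact: smooth_near_cst|exact: smooth_near_id].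
have s2 : smooth_near (fun b => phi (chart_inv d b * g^-1)%g) (chart_fun d g).
  have := @mul_smooth_near d d' c g g^-1%g Ad Ad' Ac dg dg'.
  rewrite mulgV => /(_ c1) s.
  have := @smooth_near_comp _ _ _ _ (fun b : E => (b, chart_fun d' g^-1%g)) _ _ _ s.
  rewrite /= chart_funK//; apply.
  by apply: smooth_near_pair; [exact: smooth_near_id|exact: smooth_near_cst].
(* Both factors are composed at the chart image of [g * 1 = g]. *)
have s2' : smooth_near (fun b => phi (chart_inv d b * g^-1)%g) (chart_fun d (g * psi e)%g).
  by rewrite /e chart_funK// mulg1.
apply: eq_smooth_near (smooth_near_comp s1 s2').
have c0 : (g * psi a)%g @[a --> e] --> g.
  rewrite -[X in _ --> X]mulg1; apply: cvg_mulg; first exact: cvg_cst.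
  exact: cvg_chart_inv1.
by apply: filterS (near_chart_dom c0 dg) => a da; rewrite chart_funK.
Qed.

Lemma conj_chart_e (g : G) : phi (g * psi e * g^-1)%g = e.
Proof. by rewrite /e chart_funK ?mulg1 ?mulgV//; exact: hc.2. Qed.

Lemma has_dderive_Ad (g : G) (x : E) :
  has_dderive (fun a => phi (g * psi a * g^-1)%g) e x (Ad c g x).
Proof. by apply: smooth_near_has_dderive => //; exact: conj_smooth_near. Qed.

Lemma AdD (g : G) (x y : E) : Ad c g (x + y) = Ad c g x + Ad c g y.
Proof. by apply: dderiveD => //; exact: conj_smooth_near. Qed.

Lemma AdZ (g : G) (a : R) (x : E) : Ad c g (a *: x) = a *: Ad c g x.
Proof. by apply: dderiveZ => //; exact: conj_smooth_near. Qed.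

Lemma Ad_continuous (g : G) : continuous (Ad c g).
Proof. by apply: dderive_continuous => //; exact: conj_smooth_near. Qed.

Lemma AdM (g1 g2 : G) (x : E) : Ad c (g1 * g2)%g x = Ad c g1 (Ad c g2 x).
Proof.
have s1 : smooth_near (fun a => phi (g1 * psi a * g1^-1)%g) (phi (g2 * psi e * g2^-1)%g).
  by rewrite conj_chart_e; exact: conj_smooth_near.
have <- : dderive (fun a => phi (g1 * psi (phi (g2 * psi a * g2^-1)) * g1^-1)%g) e x =
    Ad c g1 (Ad c g2 x).
  by rewrite (dderive_comp hE (@has_dderive_Ad g2 x) s1) conj_chart_e.
rewrite /Ad -/e; congr (_ x); apply: eq_near_dderive.
have c0 : (g2 * psi a * g2^-1)%g @[a --> e] --> (1 : G)%g.
  have -> : (1 : G)%g = (g2 * 1 * g2^-1)%g by rewrite mulg1 mulgV.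
  apply: cvg_mulg; last exact: cvg_cst.
  by apply: cvg_mulg; [exact: cvg_cst|exact: cvg_chart_inv1].
apply: filterS (near_chart_dom c0 hc.2) => a da.
by rewrite chart_funK// invgM !mulgA.
Qed.

Lemma Ad1 (x : E) : Ad c 1%g x = x.
Proof.
have n : \forall a \near e, phi (1 * psi a * 1^-1)%g = a.
  have ce : chart_img c e by exists 1%g => //; exact: hc.2.
  have : nbhs e (chart_img c) by apply: open_nbhs_nbhs; split => //; exact: chart_img_open.
  apply: filterS => a [g dg <-].
  by rewrite mul1g invg1 mulg1 chart_funK.
rewrite /Ad (eq_near_dderive n); apply: dderiveE => //.
exact: has_dderive_linear.
Qed.

Section Exponential.
Variable expG : E -> G.
Hypothesis hexp : is_exponential c expG.

Lemma exp0 : expG 0 = 1%g.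
Proof.
have [_ /(_ 0 0 0) h _] := hexp; apply: (@mulgI _ (expG 0)).
by rewrite mulg1; move: h; rewrite !scaler0 => <-.
Qed.

Lemma expN (x : E) : expG (- x) = (expG x)^-1%g.
Proof.
have [_ /(_ x 1 (-1)) h _] := hexp; apply: (@mulgI _ (expG x)).
by move: h; rewrite scale1r scaleN1r subrr scale0r exp0 mulgV => <-.
Qed.

Lemma expD (x : E) (s r : R) : expG ((s + r) *: x) = (expG (s *: x) * expG (r *: x))%g.
Proof. by have [_ h _] := hexp. Qed.

Lemma exp_continuous : continuous expG.
Proof. by have [[h _] _ _] := hexp. Qed.

Lemma exp_smooth_near : smooth_near (fun x => phi (expG x)) 0.
Proof.
have [s _ _] := hexp.
apply: (@smooth_map_near _ _ _ _ _ _ _ _ (id_chart E) c 0 s) => //; first exact: hc.1.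
by rewrite exp0; exact: hc.2.
Qed.

Lemma has_dderive_exp (x : E) : has_dderive (fun x => phi (expG x)) 0 x x.
Proof.
have [_ _ /(_ x)] := hexp; rewrite /has_dderive /= scale0r.
have -> : (fun h : R => h^-1 *: (phi (expG ((0 + h *: (1 : R^o)) *: x)) - phi (expG 0)))
        = (fun h : R => h^-1 *: (phi (expG (0 + h *: x)) - phi (expG 0))); last by [].
by apply/funext => h; rewrite !add0r [h *: 1]mulr1.
Qed.

Let mu (z : E * E) := phi (psi z.1 * psi z.2)%g.
(* The two exponential factors get independent variables, so that the derivative
   along the diagonal [(h, - h)] splits by additivity. *)
Let Q (z : E * E * E) := phi (expG z.1.1 * psi z.2 * expG z.1.2)%g.

Let mu_smooth : smooth_near mu (e, e).
Proof. by have [Ac c1] := hc; apply: mul_smooth_near => //; rewrite mulg1. Qed.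

Let psi_e : psi e = 1%g.
Proof. by rewrite /e chart_funK//; exact: hc.2. Qed.

Let near_expQ :
  [/\ \forall z \near ((0, 0, e) : E * E * E), chart_dom c (expG z.1.1),
      \forall z \near ((0, 0, e) : E * E * E), chart_dom c (expG z.1.2) &
      \forall z \near ((0, 0, e) : E * E * E), chart_dom c (expG z.1.1 * psi z.2)%g].
Proof.
have c1 : z.1 @[z --> ((0, 0, e) : E * E * E)] --> ((0, 0) : E * E) by exact: cvg_fst.
have c11 : expG z.1.1 @[z --> ((0, 0, e) : E * E * E)] --> (1 : G)%g.
  have c11 : z.1.1 @[z --> ((0, 0, e) : E * E * E)] --> (0 : E).
    by apply: cvg_comp c1 _; exact: cvg_fst.
  by rewrite -exp0; apply: cvg_comp c11 _; exact: exp_continuous.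
have c12 : expG z.1.2 @[z --> ((0, 0, e) : E * E * E)] --> (1 : G)%g.
  have c12 : z.1.2 @[z --> ((0, 0, e) : E * E * E)] --> (0 : E).
    by apply: cvg_comp c1 _; exact: cvg_snd.
  by rewrite -exp0; apply: cvg_comp c12 _; exact: exp_continuous.
have c2 : psi z.2 @[z --> ((0, 0, e) : E * E * E)] --> (1 : G)%g.
  by apply: cvg_comp cvg_chart_inv1; exact: cvg_snd.
split; [exact: near_chart_dom c11 hc.2|exact: near_chart_dom c12 hc.2|].
have c3 : (expG z.1.1 * psi z.2)%g @[z --> ((0, 0, e) : E * E * E)] --> (1 * 1 : G)%g.
  exact: cvg_mulg c11 c2.
rewrite mulg1 in c3.
exact: near_chart_dom c3 hc.2.
Qed.

Let Q_smooth : smooth_near Q ((0, 0), e).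
Proof.
pose z0 : E * E * E := ((0, 0), e).
have sz : smooth_near (fun z : E * E * E => z) z0 by exact: smooth_near_id.
have se (f : E * E * E -> E) : smooth_near f z0 -> f z0 = 0 ->
    smooth_near (fun z => phi (expG (f z))) z0.
  move=> sf f0; apply: (smooth_near_comp (g := fun x => phi (expG x)) sf).
  by rewrite f0; exact: exp_smooth_near.
have s1 : smooth_near (fun z => mu (phi (expG z.1.1), z.2)) z0.
  apply: (smooth_near_comp (g := mu)).
    apply: smooth_near_pair; last exact: smooth_near_snd.
    by apply: se => //; do 2 apply: smooth_near_fst.
  by rewrite /= exp0; exact: mu_smooth.
have s2 : smooth_near (fun z => mu (mu (phi (expG z.1.1), z.2), phi (expG z.1.2))) z0.
  apply: (smooth_near_comp (g := mu)).
    apply: smooth_near_pair => //.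
    by apply: se => //; apply: smooth_near_snd; apply: smooth_near_fst.
  rewrite /= exp0 {2}/mu /= -/e !psi_e.
  by rewrite mulg1; exact: mu_smooth.
apply: eq_smooth_near s2; have [n1 n2 n3] := near_expQ.
apply: filterS3 n1 n2 n3 => z d1 d2 d3.
by rewrite /mu /Q /= (chart_funK d1) (chart_funK d2) (chart_funK d3).
Qed.

Let left_field_one (x : E) : left_field c x e = x.
Proof.
rewrite /left_field psi_e.
have n : \forall b \near e, phi (1 * psi b)%g = b.
  have ce : chart_img c e by exists 1%g => //; exact: hc.2.
  have : nbhs e (chart_img c) by apply: open_nbhs_nbhs; split => //; exact: chart_img_open.
  by apply: filterS => a [g dg <-]; rewrite mul1g chart_funK.
rewrite (eq_near_dderive n); apply: dderiveE => //.
exact: has_dderive_linear.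
Qed.

Let left_field_smooth (x : E) : smooth_near (left_field c x) e.
Proof.
have := smooth_near_dderive1 hE (0, x) mu_smooth.
move=> s; have {}s : smooth_near (fun a => dderive mu (a, e) (0, x)) e.
  apply: (smooth_near_comp (f := fun a : E => (a, e))) s.
  by apply: smooth_near_pair; [exact: smooth_near_id|exact: smooth_near_cst].
apply: eq_smooth_near s; apply: nearW => a.
by rewrite dderive_partial2.
Qed.

Let Ad_expE (h y : E) : Ad c (expG h) y = dderive Q ((h, - h), e) (0, y).
Proof. by rewrite dderive_partial2 /Q /= expN. Qed.

(** The derivative of [Ad (exp (r h)) y] at [r = 0] is a mixed second derivative, in
   [r] and [b], of [exp (r h) * b * exp (- r h)].  The left factor contributes the
   derivative of the left-invariant field of [y] in direction [h]; by symmetry of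
   second derivatives, the right factor contributes minus the derivative of the
   field of [h] in direction [y]. *)
Lemma has_dderive_Ad_exp (h y : E) :
  (r^-1 *: (Ad c (expG (r *: h)) y - y)) @[r --> (0 : R)^'] --> lie_bracket c h y.
Proof.
pose D (z : E * E * E) := dderive Q z (0, y).
have sD : smooth_near D ((0, 0), e) by exact: smooth_near_dderive1.
have bracketE : lie_bracket c h y = dderive D ((0, 0), e) ((h, - h), 0).
  have -> : ((h, - h), 0) = ((h, 0), 0) + (-1) *: ((0, h), 0) :> E * E * E.
    by congr pair; rewrite /= ?scaler0 ?addr0//; congr pair;
       rewrite /= ?scaler0 ?scaleN1r ?addr0 ?add0r.
  rewrite dderiveD// dderiveZ// scaleN1r /lie_bracket /field_bracket -/e !left_field_one.
  have -> : dderive D (0, 0, e) (h, 0, 0) = dderive (left_field c y) e h.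
    rewrite dderive_partial1 dderive_partial1.
    have near0 : \forall x \near (0 : E), left_field c y (phi (expG x)) = D (x, 0, e).
      have c0 : expG x @[x --> (0 : E)] --> (1 : G)%g by rewrite -exp0; exact: exp_continuous.
      apply: filterS (near_chart_dom c0 hc.2) => x dx.
      rewrite /D dderive_partial2 /left_field chart_funK// -/e.
      have -> // : (fun b => Q (x, 0, b)) = (fun b => phi (expG x * psi b)%g).
      by apply/funext => b; rewrite /Q /= exp0 mulg1.
    have cs : smooth_near (left_field c y) (phi (expG 0)).
      by rewrite exp0; exact: left_field_smooth.
    by rewrite -(eq_near_dderive near0) (dderive_comp hE (@has_dderive_exp h) cs) exp0.
  have -> : dderive D (0, 0, e) (0, h, 0) =
      dderive (fun b => dderive Q (0, 0, b) (0, h, 0)) e y.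
    by rewrite (dderive_swap hE (0, y) (0, h, 0) Q_smooth) dderive_partial2.
  have near_e : \forall b \near e, left_field c h b = dderive Q (0, 0, b) (0, h, 0).
    have ce : chart_img c e by exists 1%g => //; exact: hc.2.
    have : nbhs e (chart_img c) by apply: open_nbhs_nbhs; split => //; exact: chart_img_open.
    apply: filterS => _ [g dg <-].
    rewrite dderive_partial1 dderive_partial2 /left_field -/e chart_funK//.
    have s : smooth_near (fun b => phi (g * psi b)%g) (phi (expG 0)).
      rewrite exp0; have [Ac c1] := hc.
      have := @mul_smooth_near c c c g 1%g Ac Ac Ac dg c1.
      rewrite mulg1 => /(_ dg) s.
      have := @smooth_near_comp _ _ _ _ (fun b : E => (phi g, b)) _ (phi 1%g) _ s.
      rewrite /= chart_funK//; apply.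
      by apply: smooth_near_pair; [exact: smooth_near_cst|exact: smooth_near_id].
    have := dderive_comp hE (@has_dderive_exp h) s; rewrite exp0 => <-.
    congr (_ h); apply: eq_near_dderive.
    have c0 : expG x @[x --> (0 : E)] --> (1 : G)%g by rewrite -exp0; exact: exp_continuous.
    apply: filterS (near_chart_dom c0 hc.2) => x dx.
    by rewrite /Q /= exp0 mul1g chart_funK// chart_funK.
  by rewrite -(eq_near_dderive near_e).
have := smooth_near_has_dderive hE (v := ((h, - h), 0)) sD; rewrite -bracketE.
rewrite /has_dderive.
have -> : (fun r => r^-1 *: (D ((0, 0, e) + r *: (h, - h, 0)) - D (0, 0, e))) =
          (fun r => r^-1 *: (Ad c (expG (r *: h)) y - y)); last by [].
have D0 : D (0, 0, e) = y by rewrite -[RHS]Ad1 -exp0 Ad_expE /D oppr0.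
apply/funext => r; rewrite D0 Ad_expE /D.
have -> // : (0, 0, e) + r *: (h, - h, 0) = (r *: h, - (r *: h), e) :> E * E * E.
by congr pair; rewrite /= ?scaler0 ?addr0//; congr pair; rewrite /= add0r ?scalerN.
Qed.

End Exponential.
End LieGroup.

(** * One-parameter groups and rotations *)

Section Curves.
Context {R : realType}.

Lemma is_derive_quotient (f : R -> R) (x df : R) : is_derive x (1 : R) f df ->
  h^-1 * (f (x + h) - f x) @[h --> (0 : R)^'] --> df.
Proof.
move=> [fd <-].
have c : h^-1 *: ((f \o shift x) (h *: (1 : R)) - f x) @[h --> (0 : R)^'] --> 'D_1 f x.
  exact: fd.
apply: cvg_trans c; apply: near_eq_cvg; apply: nearW => h /=.
by rewrite [h *: 1]mulr1 (addrC h).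
Qed.

Lemma eq_cvg_unique {E : tvsType R} {T : Type} (F : set_system T)
    {FF : ProperFilter F} (f g : T -> E) (a b : E) : hausdorff_space E -> f =1 g ->
  f x @[x --> F] --> a -> g x @[x --> F] --> b -> a = b.
Proof. by move=> hE /funext ->; exact: (@cvg_unique E hE). Qed.

Lemma curve_product {E : tvsType R} (k : R -> R) (g : R -> E) (s k' : R) (g' : E) :
  h^-1 * (k (s + h) - k s) @[h --> (0 : R)^'] --> k' ->
  h^-1 *: (g (s + h) - g s) @[h --> (0 : R)^'] --> g' ->
  h^-1 *: (k (s + h) *: g (s + h) - k s *: g s) @[h --> (0 : R)^'] --> k' *: g s + k s *: g'.
Proof.
move=> dk dg.
have ck : k (s + h) @[h --> (0 : R)^'] --> k s.
  have c : k s + h * (h^-1 * (k (s + h) - k s)) @[h --> (0 : R)^'] --> k s + 0 * k'.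
    by apply: cvgD; [exact: cvg_cst|apply: cvgM => //; exact: cvg_within].
  rewrite mul0r addr0 in c; apply: cvg_trans c; apply: near_eq_cvg; near=> h.
  have h0 : h != 0 by near: h; exact: nbhs_dnbhs_neq.
  by rewrite /= mulrA mulfV// mul1r addrC subrK.
have c : (h^-1 * (k (s + h) - k s)) *: g s + k (s + h) *: (h^-1 *: (g (s + h) - g s))
    @[h --> (0 : R)^'] --> k' *: g s + k s *: g'.
  by apply: cvg_add; apply: cvg_scale => //; exact: cvg_cst.
apply: cvg_trans c; apply: near_eq_cvg; apply: nearW => h /=.
rewrite scalerA [_ * h^-1]mulrC -!scalerA -scalerDr scalerBl scalerBr addrC.
by rewrite addrA subrK.
Unshelve. all: by end_near. Qed.

End Curves.

Section Rotation.
Context {R : realType} {E : tvsType R} (hE : hausdorff_space E).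
Variables (T : R -> E -> E) (B : E -> E).
Hypotheses (T0 : forall x, T 0 x = x) (TZ : forall s a x, T s (a *: x) = a *: T s x).
Hypothesis BZ : forall a x, B (a *: x) = a *: B x.
Hypothesis dT : forall s x,
  h^-1 *: (T (s + h) x - T s x) @[h --> (0 : R)^'] --> T s (B x).

(** On a plane where [B] acts as multiplication by [i a] on a complex line, [T s]
   is the rotation of angle [s a]: undoing the rotation leaves a
   curve of derivative zero. *)
Lemma flow_rotation (u v : E) (a s : R) : B u = - a *: v -> B v = a *: u ->
  T s u = cos (s * a) *: u - sin (s * a) *: v.
Proof.
pose g x s := T s x.
have key x y : B x = - a *: y -> B y = a *: x ->
    cos (s * a) *: g x s + sin (s * a) *: g y s = x.
  move=> hx hy.
  have dgx r : t^-1 *: (g x (r + t) - g x r) @[t --> (0 : R)^'] --> - a *: g y r.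
    by rewrite /g -TZ -hx; exact: dT.
  have dgy r : t^-1 *: (g y (r + t) - g y r) @[t --> (0 : R)^'] --> a *: g x r.
    by rewrite /g -TZ -hy; exact: dT.
  have dcos r : t^-1 * (cos ((r + t) * a) - cos (r * a)) @[t --> (0 : R)^'] -->
      - (a * sin (r * a)).
    apply: (@is_derive_quotient _ (fun s => cos (s * a))).
    by apply: is_derive_eq; rewrite /GRing.scale /=; ring.
  have dsin r : t^-1 * (sin ((r + t) * a) - sin (r * a)) @[t --> (0 : R)^'] -->
      a * cos (r * a).
    apply: (@is_derive_quotient _ (fun s => sin (s * a))).
    by apply: is_derive_eq; rewrite /GRing.scale /=; ring.
  have g0 (z : E) : g z 0 = z by exact: T0.
  have := @zero_derivative_constant _ _
    (fun s => cos (s * a) *: g x s + sin (s * a) *: g y s) hE _ s.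
  rewrite /= mul0r cos0 sin0 scale0r addr0 scale1r g0; apply => r.
  have dx := curve_product (k := fun r => cos (r * a)) (dcos r) (dgx r).
  have dy := curve_product (k := fun r => sin (r * a)) (dsin r) (dgy r).
  have cxy : t^-1 *: (cos ((r + t) * a) *: g x (r + t) - cos (r * a) *: g x r) +
      t^-1 *: (sin ((r + t) * a) *: g y (r + t) - sin (r * a) *: g y r)
      @[t --> (0 : R)^'] --> - (a * sin (r * a)) *: g x r + cos (r * a) *: (- a *: g y r) +
            (a * cos (r * a) *: g y r + sin (r * a) *: (a *: g x r)).
    exact: cvg_add dx dy.
  have z0 : - (a * sin (r * a)) *: g x r + cos (r * a) *: (- a *: g y r) +
            (a * cos (r * a) *: g y r + sin (r * a) *: (a *: g x r)) = 0.
    rewrite !scalerA mulrN [cos _ * a]mulrC [sin _ * a]mulrC !scaleNr.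
    by rewrite [X in _ + X]addrC addrACA !addNr addr0.
  rewrite z0 in cxy; apply: cvg_trans cxy; apply: near_eq_cvg; apply: nearW => t /=.
  by rewrite -scalerDr opprD addrACA.
move=> hu hv; have e1 := key u v hu hv.
have e2 : cos (s * a) *: g v s - sin (s * a) *: g u s = v.
  have gN : g (- u) s = - g u s by rewrite -(scaleN1r u) /g TZ scaleN1r.
  rewrite -[RHS](key v (- u)) ?gN ?scalerN ?hv ?scaleNr ?opprK//.
  by rewrite -(scaleN1r u) BZ hu scaleN1r scaleNr opprK.
rewrite -[LHS]/(g u s); move: (g u s) (g v s) e1 e2 => x y <- <-.
rewrite scalerBr scalerDr !scalerA opprB addrACA [sin _ * cos _]mulrC subrr addr0.
by rewrite -scalerDl -!expr2 cos2Dsin2 scale1r.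
Qed.

End Rotation.

Section Flow.
Context {R : realType} {E : tvsType R} {G : lieGroupType E}.
Variables (c : chart E G) (expG : E -> G).
Hypotheses (hE : hausdorff_space E) (hc : chart_at_one c) (hexp : is_exponential c expG).
Local Notation br := (lie_bracket c).

Lemma lie_bracketC (x y : E) : br x y = - br y x.
Proof. by rewrite /lie_bracket /field_bracket opprB. Qed.

Lemma lie_bracketxx (x : E) : br x x = 0.
Proof. by rewrite /lie_bracket /field_bracket subrr. Qed.

(** [br h] is the derivative of a family of linear maps. *)
Lemma lie_bracketDr (h x y : E) : br h (x + y) = br h x + br h y.
Proof.
have c1 : r^-1 *: (Ad c (expG (r *: h)) x - x) + r^-1 *: (Ad c (expG (r *: h)) y - y)
    @[r --> (0 : R)^'] --> br h x + br h y.
  by apply: cvg_add; exact: has_dderive_Ad_exp.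
apply: (eq_cvg_unique hE _ (@has_dderive_Ad_exp _ _ _ c hE hc expG hexp h (x + y)) c1) => r.
by rewrite AdD// -scalerDr opprD addrACA.
Qed.

Lemma lie_bracketZr (h x : E) (a : R) : br h (a *: x) = a *: br h x.
Proof.
have c1 : a *: (r^-1 *: (Ad c (expG (r *: h)) x - x)) @[r --> (0 : R)^'] --> a *: br h x.
  by apply: cvg_scale; [exact: cvg_cst|exact: has_dderive_Ad_exp].
apply: (eq_cvg_unique hE _ (@has_dderive_Ad_exp _ _ _ c hE hc expG hexp h (a *: x)) c1) => r.
by rewrite AdZ// -scalerBr !scalerA mulrC.
Qed.

Lemma Ad_flow (h y : E) (s : R) :
  r^-1 *: (Ad c (expG ((s + r) *: h)) y - Ad c (expG (s *: h)) y) @[r --> (0 : R)^']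
    --> Ad c (expG (s *: h)) (br h y).
Proof.
have c1 : Ad c (expG (s *: h)) (r^-1 *: (Ad c (expG (r *: h)) y - y)) @[r --> (0 : R)^']
    --> Ad c (expG (s *: h)) (br h y).
  have d0 := @has_dderive_Ad_exp _ _ _ c hE hc expG hexp h y.
  exact: (cvg_comp _ _ d0 (@Ad_continuous _ _ _ c hE hc (expG (s *: h)) (br h y))).
apply: cvg_trans c1; apply: near_eq_cvg; apply: nearW => r /=.
have AdB (x : E) : Ad c (expG (s *: h)) (x - y) =
    Ad c (expG (s *: h)) x - Ad c (expG (s *: h)) y.
  by rewrite AdD// -scaleN1r AdZ// scaleN1r.
by rewrite AdZ// AdB (expD hexp) AdM.
Qed.

Lemma Ad_rotation (h u v : E) (a s : R) : br h u = - a *: v -> br h v = a *: u ->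
  Ad c (expG (s *: h)) u = cos (s * a) *: u - sin (s * a) *: v.
Proof.
move=> hu hv.
apply: (@flow_rotation _ _ hE (fun s => Ad c (expG (s *: h))) (br h)) => //.
- by move=> x; rewrite scale0r (exp0 hexp) Ad1.
- by move=> r b x; rewrite AdZ.
- by move=> b x; exact: lie_bracketZr.
- by move=> r x; exact: Ad_flow.
Qed.

End Flow.

(** * Averages over the torus of a Cartan subalgebra *)

Section CartanAveraging.
Context {R : realType} {E : tvsType R}.
Variables (br T : E -> E -> E) (t : set E) (p : {linear E -> E}).
Hypotheses (brC : forall x y, br x y = - br y x) (brxx : forall x, br x x = 0).
Hypotheses (brD : forall h x y, br h (x + y) = br h x + br h y).
Hypotheses (brZ : forall h a x, br h (a *: x) = a *: br h x).
Hypotheses (TD : forall h x y, T h (x + y) = T h x + T h y).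
Hypotheses (TZ : forall h a x, T h (a *: x) = a *: T h x).
Hypothesis T_rotation : forall h u v (a s : R), br h u = - a *: v -> br h v = a *: u ->
  T (s *: h) u = cos (s * a) *: u - sin (s * a) *: v.
Hypotheses (ht : elliptic_cartan br t) (hp : equivariant_projection br t p).

Lemma bracket0 (h : E) : br h 0 = 0.
Proof. by have := brZ h 0 0; rewrite !scale0r. Qed.

Lemma bracketN (h x : E) : br h (- x) = - br h x.
Proof. by rewrite -scaleN1r brZ scaleN1r. Qed.

Lemma cartan0 : t 0.
Proof. by have [[[[+ _] _] _] _ _] := ht; rewrite inE. Qed.

Lemma cartan_linear (a : R) (x y : E) : t x -> t y -> t (a *: x + y).
Proof.
have [[[[_ lt] _] _] _ _] := ht => tx ty.
by have := lt a x y; rewrite !inE; apply.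
Qed.

Lemma cartanZ (a : R) (x : E) : t x -> t (a *: x).
Proof. by move=> tx; rewrite -[_ *: _]addr0; apply: cartan_linear => //; exact: cartan0. Qed.

Lemma cartan_abelian (x y : E) : t x -> t y -> br x y = 0.
Proof. by have [[[_ h] _] _ _] := ht; exact: h. Qed.

(** Otherwise [t] and [x] would span a larger abelian subalgebra. *)
Lemma cartan_centralizer (x : E) : (forall h, t h -> br h x = 0) -> t x.
Proof.
move=> xt; pose s := [set z | exists a y, t y /\ z = a *: x + y].
have [[_ tmax] _ _] := ht.
have xt' y : t y -> br x y = 0 by move=> ty; rewrite brC xt ?oppr0.
have <- : s = t.
  apply: tmax => [|y ty]; last by exists 0, y; rewrite scale0r add0r.
  split; first split.
  - by rewrite inE; exists 0, 0; split; [exact: cartan0|rewrite scale0r addr0].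
  - move=> a _ _ /[!inE] -[b [y [ty ->]]] [d [z [tz ->]]].
    exists (a * b + d), (a *: y + z); split; first exact: cartan_linear.
    by rewrite scalerDr scalerA addrACA -scalerDl.
  - move=> _ _ [a [y [ty ->]]] [b [z [tz ->]]].
    have E1 : br (a *: x + y) x = 0 by rewrite brC brD brZ brxx xt'// scaler0 addr0 oppr0.
    have E2 : br (a *: x + y) z = 0.
      by rewrite brC brD brZ xt// scaler0 cartan_abelian// addr0 oppr0.
    by rewrite brD brZ E1 E2 scaler0 addr0.
by exists 1, 0; split; [exact: cartan0|rewrite scale1r addr0].
Qed.

Lemma projection_in (x : E) : t (p x).
Proof. by have [<- _ _] := hp; exists x. Qed.

Lemma projection_id (x : E) : t x -> p x = x.
Proof. by have [_ h _] := hp; exact: h. Qed.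

Lemma projection_bracket (h x : E) : t h -> p (br h x) = 0.
Proof.
move=> th; have [_ _ ->//] := hp; apply: cartan_abelian => //; exact: projection_in.
Qed.

(** Degenerate case of the rotation: angle 0 and second vector 0. *)
Lemma flow_fixed (h x : E) : br h x = 0 -> T h x = x.
Proof.
move=> hx; have := @T_rotation h x 0 0 1.
rewrite oppr0 !scale0r bracket0 scale1r mulr0 cos0 sin0 scale1r scale0r subr0.
exact.
Qed.

(** Real and imaginary part of a root vector whose root takes the values [i th]:
   for all [h] in [t], the bracket of [h] with [u + i v] is [i th(h) (u + i v)]. *)
Definition root_pair (th : E -> R) (u v : E) := forall h, t h ->
  br h u = - th h *: v /\ br h v = th h *: u.

Definition root_vector (u : E) := exists th v, root_pair th u v.

Lemma root_pair_rotate (th : E -> R) (u v : E) (a b : R) : root_pair th u v ->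
  root_pair th (a *: u - b *: v) (a *: v + b *: u).
Proof.
move=> uv h /uv[hu hv]; split.
  rewrite brD bracketN !brZ hu hv !scaleNr scalerN scalerDr opprD !scalerA.
  by rewrite [a * _]mulrC [b * _]mulrC.
rewrite brD !brZ hu hv scaleNr scalerN scalerBr !scalerA.
by rewrite [a * _]mulrC [b * _]mulrC.
Qed.

Definition average1 (h x : E) := 2^-1 *: (x + T h x).

Definition average (hs : seq E) (x : E) := foldr average1 x hs.

Lemma average1_fixed (h x : E) : br h x = 0 -> average1 h x = x.
Proof.
move=> hx; rewrite /average1 flow_fixed// -[X in X + _]scale1r -[X in _ + X]scale1r.
by rewrite -scalerDl scalerA mulVf ?scale1r// pnatr_eq0.
Qed.

Lemma average_cartan (hs : seq E) (x : E) : (forall h, h \in hs -> t h) -> t x ->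
  average hs x = x.
Proof.
move=> ths tx; elim: hs ths => //= h hs IHhs ths.
rewrite IHhs => [|k khs]; last by apply: ths; rewrite inE khs orbT.
by apply: average1_fixed; apply: cartan_abelian => //; apply: ths; rewrite inE eqxx.
Qed.

Lemma averageD (hs : seq E) (x y : E) : average hs (x + y) = average hs x + average hs y.
Proof.
elim: hs => //= h hs ->; rewrite /average1 TD -scalerDr; congr (_ *: _).
exact: addrACA.
Qed.

Lemma averageZ (hs : seq E) (a : R) (x : E) : average hs (a *: x) = a *: average hs x.
Proof.
elim: hs => //= h hs ->; rewrite /average1 TZ -scalerDr !scalerA.
by rewrite mulrC.
Qed.

Lemma average_root_pair (hs : seq E) (th : E -> R) (u v : E) :
  (forall h, h \in hs -> t h) -> root_pair th u v ->
  root_pair th (average hs u) (average hs v).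
Proof.
move=> ths uv; elim: hs ths => //= h hs IHhs ths.
have {IHhs}uv' : root_pair th (average hs u) (average hs v).
  by apply: IHhs => k khs; apply: ths; rewrite inE khs orbT.
have th' : t h by apply: ths; rewrite inE eqxx.
move: (average hs u) (average hs v) uv' => u' v' uv'.
have [hu hv] := uv' h th'.
have hv' : br h v' = - th h *: (- u') by rewrite scalerN scaleNr opprK.
have hu' : br h (- u') = th h *: v' by rewrite bracketN hu scaleNr opprK.
have := T_rotation 1 hu hv; rewrite scale1r mul1r => Tu.
have := T_rotation 1 hv' hu'; rewrite scale1r mul1r scalerN opprK => Tv.
have := root_pair_rotate (2^-1 * (1 + cos (th h))) (2^-1 * sin (th h)) uv'.
rewrite /average1 Tu Tv -!scalerA !scalerDl !scale1r -scalerBr -scalerDr.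
by rewrite !addrA.
Qed.

(** By equivariance [p] vanishes on brackets with [t], and [u] is such a bracket. *)
Lemma projection_root_pair (th : E -> R) (u v h : E) : root_pair th u v -> t h ->
  th h != 0 -> p u = 0.
Proof.
move=> uv th' thh; have [_ hv] := uv h th'.
have := projection_bracket v th'; rewrite hv linearZ /= => /eqP.
by rewrite scaler_eq0 (negbTE thh) /= => /eqP.
Qed.

Lemma root_pair_cartan (th : E -> R) (u v : E) : root_pair th u v ->
  (forall h, t h -> th h = 0) -> t u.
Proof.
move=> uv th0; apply: cartan_centralizer => h th'; have [-> _] := uv h th'.
by rewrite th0// oppr0 scale0r.
Qed.

(** If [th h != 0], the rotation by the angle [pi] is [- 1] on the plane of [u] and
   [v], so averaging over it and the identity annihilates [u]. *)
Lemma root_vector_average1 (u : E) : root_vector u ->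
  exists2 h, t h & average1 h u = p u.
Proof.
move=> [th [v uv]].
have [[h [th' thh]]|nth] := pselect (exists h, t h /\ th h != 0).
  exists ((pi / th h) *: h); first exact: cartanZ.
  have [hu hv] := uv h th'.
  rewrite /average1 (T_rotation _ hu hv) divfK// cospi sinpi scaleN1r scale0r subr0.
  by rewrite subrr scaler0 (projection_root_pair uv th').
exists 0; first exact: cartan0.
have tu : t u.
  by apply: root_pair_cartan uv _ => h th'; apply: contrapT => /eqP ?; apply: nth; exists h.
by rewrite projection_id// average1_fixed// cartan_abelian//; exact: cartan0.
Qed.

Lemma projection_average (hs : seq E) (u : E) : (forall h, h \in hs -> t h) ->
  root_vector u -> p (average hs u) = p u.
Proof.
move=> ths [th [v uv]].
have [[h [th' thh]]|nth] := pselect (exists h, t h /\ th h != 0).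
  rewrite (projection_root_pair uv th' thh).
  exact: projection_root_pair (average_root_pair ths uv) th' thh.
have tu : t u.
  by apply: root_pair_cartan uv _ => h th'; apply: contrapT => /eqP ?; apply: nth; exists h.
by rewrite average_cartan.
Qed.

(** Averaging once more neither moves what has already been projected into [t] nor
   leaves the planes of the remaining root vectors, so these can be treated one
   after the other. *)
Lemma root_vectors_average (us : seq E) : (forall u, u \in us -> root_vector u) ->
  exists2 hs, (forall h, h \in hs -> t h) & forall u, u \in us -> average hs u = p u.
Proof.
elim: us => [|u us IHus] rus; first by exists [::].
have [hs ths Ehs] : exists2 hs, (forall h, h \in hs -> t h) &
    forall u, u \in us -> average hs u = p u.
  by apply: IHus => v vus; apply: rus; rewrite inE vus orbT.
have ru : root_vector u by apply: rus; rewrite inE eqxx.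
have ru' : root_vector (average hs u).
  by have [th [v uv]] := ru; exists th, (average hs v); exact: average_root_pair.
have [h th Eh] := root_vector_average1 ru'.
exists (h :: hs) => [k|w]; rewrite inE => /orP[/eqP->//|].
- exact: ths.
- by rewrite /= Eh projection_average.
move=> wus /=; rewrite Ehs// average1_fixed//; apply: cartan_abelian => //.
exact: projection_in.
Qed.

(** The real parts of the elements of [g_alg] have this form. *)
Definition algebraic (x : E) :=
  exists2 us : seq E, (forall u, u \in us -> root_vector u) & x = \sum_(u <- us) u.

Lemma average_sum (hs us : seq E) : average hs (\sum_(u <- us) u) = \sum_(u <- us) average hs u.
Proof.
elim: us => [|u us IHus]; last by rewrite !big_cons averageD IHus.
by rewrite !big_nil; have := averageZ hs 0 0; rewrite !scale0r.
Qed.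

Lemma algebraic_average (xs : seq E) : (forall x, x \in xs -> algebraic x) ->
  exists2 hs, (forall h, h \in hs -> t h) & forall x, x \in xs -> average hs x = p x.
Proof.
move=> axs.
have [us rus Hus] : exists2 us : seq E, (forall u, u \in us -> root_vector u) &
    forall hs : seq E, (forall u, u \in us -> average hs u = p u) ->
    forall x, x \in xs -> average hs x = p x.
  elim: xs axs => [|x xs IHxs] axs; first by exists [::].
  have [us rus Hus] : exists2 us : seq E, (forall u, u \in us -> root_vector u) &
      forall hs : seq E, (forall u, u \in us -> average hs u = p u) ->
      forall x, x \in xs -> average hs x = p x.
    by apply: IHxs => y yxs; apply: axs; rewrite inE yxs orbT.
  have [vs rvs ->] : algebraic x by apply: axs; rewrite inE eqxx.
  exists (vs ++ us) => [u|hs Ehs y].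
    by rewrite mem_cat => /orP[]; [exact: rvs|exact: rus].
  rewrite inE => /orP[/eqP->|]; last first.
    by apply: Hus => u uus; apply: Ehs; rewrite mem_cat uus orbT.
  rewrite average_sum linear_sum; apply: eq_big_seq => u uvs.
  by apply: Ehs; rewrite mem_cat uvs.
by have [hs ths /Hus Ehs] := root_vectors_average rus; exists hs.
Qed.

(** A nonzero vector of [root_space t alpha] makes [alpha] either a root, purely
   imaginary on [t] by ellipticity, or zero on [t]. *)
Lemma root_space_vector (alpha : complexify E -> R[i]) (x : complexify E) (a : R[i]) :
  tC_functional t alpha -> root_space br t alpha x -> root_vector (a *: x).1.
Proof.
move=> la xa; have [->|x0] := eqVneq x 0.
  exists (fun=> 0), 0 => h _.
  by rewrite scaler0 /= bracket0 oppr0 !scale0r.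
have re0 h : t h -> complex.Re (alpha ((h, 0) : complexify E)) = 0.
  move=> th; have [[k [tk ak]]|na] :=
    pselect (exists k, complexify_set t k /\ alpha k != 0).
    have [_ _ ell] := ht; apply: ell => //.
    by split => //; [exists k|exists x].
  have -> : alpha ((h, 0) : complexify E) = 0; last by [].
  apply: contrapT => /eqP ?; apply: na; exists (h, 0); split => //.
  by split => //; exact: cartan0.
exists (fun h => complex.Im (alpha ((h, 0) : complexify E))).
exists (complex.Re a *: x.2 + complex.Im a *: x.1).
apply: (@root_pair_rotate _ x.1 x.2 (complex.Re a) (complex.Im a)) => h th.
have := xa ((h, 0) : complexify E).
have tC : complexify_set t ((h, 0) : complexify E) by split => //; exact: cartan0.
move=> /(_ tC) => -[].
have br0 y : br 0 y = 0 by rewrite brC bracket0 oppr0.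
rewrite re0 // !br0 subr0 addr0 !scale0r sub0r add0r => -> ->.
by rewrite scaleNr.
Qed.

Lemma algebraic_dense (x : E) (U : set E) : nbhs x U -> exists2 y, algebraic y & U y.
Proof.
rewrite nbhsE => -[V [oV Vx] VU].
have [_ dg _] := ht.
pose O : set (complexify E) := V `*` setT.
have [[y z] [[/= Vy _] [n [a [v [va yz]]]]]] : O `&` g_alg br t !=set0.
  apply: dg; first by exists ((x, 0) : complexify E).
  by apply: open_setX => //; exact: openT.
exists y; last exact: VU.
exists [seq (a i *: v i).1 | i <- enum 'I_n] => [u /mapP[i _ ->]|].
  by have [alpha la xa] := va i; exact: root_space_vector la xa.
rewrite big_map big_enum /=.
have -> : y = (\sum_(i < n) a i *: v i).1 by rewrite -yz.
exact: (big_morph (fun w : complexify E => w.1)).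
Qed.

End CartanAveraging.

(** * Invariant convex sets *)

(** The torus flow [T] enters through averages that attain [p] simultaneously at any
   finitely many elements of the dense set [A]. *)
Section ConvexSets.
Context {R : realType} {E : tvsType R}.
Variables (T : E -> E -> E) (t : set E) (p : {linear E -> E}) (pc : continuous p).
Hypothesis TD : forall h x y, T h (x + y) = T h x + T h y.
Hypothesis TZ : forall h a x, T h (a *: x) = a *: T h x.
Hypothesis pt : forall x, t (p x).
Hypothesis pid : forall x, t x -> p x = x.
Hypothesis avt : forall (hs : seq E) x, (forall h, h \in hs -> t h) -> t x -> average T hs x = x.
Variable A : set E.
Hypothesis Aav : forall xs : seq E, (forall x, x \in xs -> A x) ->
  exists2 hs : seq E, (forall h, h \in hs -> t h) &
    forall x, x \in xs -> average T hs x = p x.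
Hypothesis Adense : forall (x : E) (U : set E), nbhs x U -> exists2 y, A y & U y.

Lemma half_combination (C : set E) (x y : E) : convex_set C -> C x -> C y ->
  C (2^-1 *: (x + y)).
Proof.
move=> cC Cx Cy; have := @convex_combination _ _ C x y 2^-1 cC Cx Cy.
have -> : 1 - 2^-1 = 2^-1 :> R by field.
by rewrite scalerDr; apply; lra.
Qed.

(** The translation by [p x - p y] keeps an approximation [y] of [x] inside the open
   set while giving it the projection of [x], which averaging then attains
   exactly. *)
Lemma open_convex_projection (C : set E) : open C -> convex_set C ->
  (forall h x, C x -> C (T h x)) -> p @` C = C `&` t.
Proof.
move=> oC cC TC; apply/seteqP; split=> [_ [x Cx <-]|x [Cx tx]]; last first.
  by exists x => //; exact: pid.
split; last exact: pt.
have cf : y - p y + p x @[y --> x] --> x - p x + p x.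
  apply: cvg_add; last exact: cvg_cst.
  apply: cvg_add; first exact: cvg_id.
  by apply: (@continuous_comp _ _ _ p -%R); [exact: pc|exact: opp_continuous].
rewrite subrK in cf.
have [y Ay Cy] := Adense (cf _ (open_nbhs_nbhs (conj oC Cx))).
have [|hs ths Ehs] := @Aav [:: y]; first by move=> _ /[!inE] /eqP ->.
have avC z : C z -> C (average T hs z).
  elim: hs {ths Ehs} => //= h hs IHhs /IHhs Cz.
  by apply: half_combination => //; exact: TC.
have := avC _ Cy; rewrite !averageD//.
have -> : - p y = (-1) *: p y by rewrite scaleN1r.
rewrite averageZ// Ehs ?inE// !(avt ths)//.
by rewrite scaleN1r subrr add0r.
Qed.

Lemma dual_linear (l : dual E) (a : R) (x y : E) : l (a *: x + y) = a *: l x + l y.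
Proof. by case: l => l /= /[!inE] -[+ _]; exact. Qed.

Lemma dualD (l : dual E) (x y : E) : l (x + y) = l x + l y.
Proof. by have := dual_linear l 1 x y; rewrite !scale1r. Qed.

Lemma dual0 (l : dual E) : l 0 = 0.
Proof. by apply: (@addrI _ (l 0)); rewrite addr0 -dualD addr0. Qed.

Lemma dualN (l : dual E) (x : E) : l (- x) = - l x.
Proof. by apply/eqP; rewrite -subr_eq0 opprK -dualD addNr dual0. Qed.

Lemma dualZ (l : dual E) (a : R) (x : E) : l (a *: x) = a * l x.
Proof. by have := dual_linear l a x 0; rewrite !addr0 dual0 addr0. Qed.

Lemma dual_continuous (l : dual E) : continuous l.
Proof. by case: l => l /= /[!inE] -[_ +]. Qed.

Lemma dual_half (C : set (dual E)) (l m : dual E) : convex_set C -> C l -> C m ->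
  exists2 k : dual E, C k & forall x, k x = 2^-1 * (l x + m x).
Proof.
move=> cC Cl Cm.
have h1 : (2^-1 : R) <= 1 by lra.
have h0 : (0 : R) <= 2^-1 by lra.
have := cC l m (Itv01 h0 h1) (mem_set Cl) (mem_set Cm); rewrite inE => Ck.
exists ((2^-1 : R) *: l + (1 - 2^-1 : R) *: m : dual E) => // x.
have -> : 1 - 2^-1 = 2^-1 :> R by field.
by rewrite mulrDr.
Qed.

(** The conditions [`|q x - m x| < e] for [x] in a finite list generate a filter on
   [C] that converges pointwise, that is weakly-star, to [q]. *)
Lemma weak_star_closure (C : set (dual E)) (q : dual E) : closed C ->
  (forall (xs : seq E) (e : R), 0 < e ->
     exists2 m : dual E, C m & forall x, x \in xs -> `|q x - m x| < e) -> C q.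
Proof.
move=> clC H.
pose B (d : seq E * R) := [set m : dual E | C m /\ forall x, x \in d.1 -> `|q x - m x| < d.2].
pose F := filter_from [set d : seq E * R | 0 < d.2] B.
have FF : ProperFilter F.
  apply: filter_from_proper; last by move=> [xs e] /= e0; have [m] := H xs e e0; exists m.
  apply: filter_from_filter; first by exists ([::], 1) => /=; exact: ltr01.
  move=> [xs d] [ys e] /= d0 e0; exists (xs ++ ys, Num.min d e) => /=.
    by rewrite lt_min d0.
  move=> m [Cm /= mxy]; split; split => //= x xxs.
    by have := mxy x; rewrite mem_cat xxs lt_min => /(_ isT) /andP[].
  by have := mxy x; rewrite mem_cat xxs orbT lt_min => /(_ isT) /andP[].
have FC : F C by exists ([::], 1) => [|m []//]; exact: ltr01.
have Fq : F --> q.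
  have Fp : {ptws, ((@dual_fun _ E : dual E -> E -> R^o) @ F) --> (q : E -> R^o)}.
    apply/pointwise_cvgP => x; apply/cvgrPdist_lt => e e0.
    exists ([:: x], e) => //= m [Cm mx]; apply: mx.
    by rewrite inE.
  move=> W [_ [[V oV <-] Vq VW]].
  have : F (@dual_fun _ E @^-1` V).
    by apply: Fp; exact: open_nbhs_nbhs.
  by apply: filterS.
by apply: (@closed_cvg _ _ F FF id C _ _ _ Fq).
Qed.

(** Boundedness from above on an open set makes the functionals of [C] with a given
   value at one of its points equicontinuous.  Averages that agree with [p] at such a
   point give functionals with the same value there, so that approximation at
   algebraic vectors extends to all vectors. *)
Lemma semi_equicontinuous_projection (C : set (dual E)) :
  semi_equicontinuous C -> closed C -> convex_set C ->
  (forall h l, C l -> exists2 m : dual E, C m & forall x, m x = l (T h x)) ->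
  dual_restrict pc @` C = C `&` ker_annihilator p.
Proof.
move=> [U [oU [x1 Ux1] [M UM]]] clC cC TC; apply/seteqP; split; last first.
  move=> l [Cl lp]; exists l => //; apply/val_inj/funext => x /=.
  have : l (x - p x) = 0 by apply: lp; rewrite linearB /= (pid (pt x)) subrr.
  by rewrite dualD dualN => /eqP; rewrite subr_eq0 => /eqP.
move=> _ [l Cl <-]; split; last by move=> x /= ->; exact: dual0.
have avC hs : exists2 m : dual E, C m & forall x, m x = l (average T hs x).
  elim: hs l Cl => [|h hs IHhs] l Cl; first by exists l.
  have [m Cm Em] := TC h l Cl.
  have [k Ck Ek] := dual_half cC Cl Cm.
  have [n Cn En] := IHhs k Ck; exists n => // x.
  by rewrite En Ek Em /= /average1 dualZ dualD.
have CM m x : C m -> U x -> m x <= M.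
  move=> Cm Ux; rewrite -lee_fin.
  have : (`|support_function C x| <= M%:E)%E by exact: UM.
  apply: le_trans; apply: le_trans (lee_abs _).
  by apply: ereal_sup_ubound; exists m.
apply: weak_star_closure => // xs e e0.
have [x0 Ax0 Ux0] := Adense (open_nbhs_nbhs (conj oU Ux1)).
(* For functionals of [C] with the prescribed value at [x0], the bound [M] becomes
   the two-sided bound [K] on the symmetric neighbourhood [W] of 0. *)
pose W := [set w | U (x0 + w) /\ U (x0 - w)].
have nW : nbhs 0 W.
  have c1 : x0 + w @[w --> (0 : E)] --> x0 + 0.
    by apply: cvg_add; [exact: cvg_cst|exact: cvg_id].
  have c2 : x0 - w @[w --> (0 : E)] --> x0 - 0.
    by apply: cvg_add; [exact: cvg_cst|exact: opp_continuous].
  rewrite addr0 in c1; rewrite subr0 in c2.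
  by apply: filterI; [apply: c1|apply: c2]; exact: open_nbhs_nbhs.
pose K := M - l (p x0).
have mW m w : C m -> m x0 = l (p x0) -> W w -> `|m w| <= K.
  move=> Cm mx0 [/(CM m _ Cm) + /(CM m _ Cm)]; rewrite !dualD dualN mx0 => h1 h2.
  by rewrite ler_norml /K; apply/andP; split; lra.
have K0 : 0 <= K.
  have [|hs ths Ehs] := @Aav [:: x0]; first by move=> _ /[!inE] /eqP ->.
  have [m Cm Em] := avC hs; apply: le_trans (mW m 0 Cm _ _) => //.
    by rewrite Em Ehs// inE.
  exact: nbhs_singleton.
(* [K] may be 0, hence the denominator [K + 1]. *)
pose d := e / (2 * (K + 1)).
have d0 : 0 < d by rewrite divr_gt0// mulr_gt0//; lra.
have approx x : exists y, [/\ A y, W (d^-1 *: (x - y)) & `|l (p (x - y))| < e / 2].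
  have c0 : x - y @[y --> x] --> x - x.
    by apply: cvg_add; [exact: cvg_cst|exact: opp_continuous].
  have c1 : d^-1 *: (x - y) @[y --> x] --> d^-1 *: (x - x).
    by apply: cvg_scale => //; exact: cvg_cst.
  have c2 : l (p (x - y)) @[y --> x] --> l (p (x - x)).
    have clp := @continuous_comp _ _ _ p l (x - x) (@pc _) (@dual_continuous l _).
    exact: (cvg_comp (fun y => x - y) (l \o p) c0 clp).
  rewrite subrr scaler0 in c1; rewrite subrr linear0 dual0 in c2.
  have n2 : \forall y \near x, `|l (p (x - y))| < e / 2.
    have e2 : 0 < e / 2 by rewrite divr_gt0.
    by have /cvgr0Pnorm_lt/(_ _ e2) := c2.
  have n1 : \forall y \near x, W (d^-1 *: (x - y)) by exact: c1.
  have [y Ay [Wy ly]] := Adense (filterI n1 n2).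
  by exists y.
have [f Hf] := choice approx.
have [|hs ths Ehs] := @Aav (x0 :: map f xs).
  move=> y; rewrite inE => /orP[/eqP->//|/mapP[x _ ->]].
  by have [] := Hf x.
have [m Cm Em] := avC hs; exists m => // x xxs.
have [Ay Wy ly] := Hf x.
have mfx : m (f x) = l (p (f x)) by rewrite Em Ehs// inE map_f// orbT.
have mx0 : m x0 = l (p x0) by rewrite Em Ehs// inE eqxx.
have mxf : `|m (x - f x)| <= d * K.
  have -> : x - f x = d *: (d^-1 *: (x - f x)) by rewrite scalerA mulfV ?scale1r// gt_eqF.
  by rewrite dualZ normrM gtr0_norm// ler_pM2l// mW.
have dK : d * K <= e / 2.
  rewrite /d -mulrA ler_pM2l// ler_pdivrMl ?mulr_gt0//; last by lra.
  by rewrite mulrAC; lra.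
have -> : dual_restrict pc l x - m x = l (p (x - f x)) - m (x - f x).
  by rewrite /= linearB /= !dualD !dualN mfx; ring.
by rewrite (le_lt_trans (ler_normB _ _))//; lra.
Qed.

End ConvexSets.

Theorem theorem3p10 (R : realType) (E : tvsType R) (G : lieGroupType E)
    (c : chart E G) (expG : E -> G) (t : set E) (p : {linear E -> E})
    (hE : hausdorff_space E)
    (hG : connected [set: G])
    (hc : chart_at_one c)
    (hexp : is_exponential c expG)
    (ht : elliptic_cartan (lie_bracket c) t)
    (pc : continuous p)
    (hp : equivariant_projection (lie_bracket c) t p) :
  (forall C : set E, open C -> Ad_invariant c C -> convex_set C ->
     p @` C = C `&` t) /\
  (forall C : set (dual E), semi_equicontinuous C -> closed C ->
     convex_set C -> coAd_invariant c C ->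
     dual_restrict pc @` C = C `&` ker_annihilator p).
Proof.
pose T h x := Ad c (expG h) x.
have TD h x y : T h (x + y) = T h x + T h y by exact: AdD.
have TZ h a x : T h (a *: x) = a *: T h x by exact: AdZ.
have rot h u v a s : lie_bracket c h u = - a *: v -> lie_bracket c h v = a *: u ->
    T (s *: h) u = cos (s * a) *: u - sin (s * a) *: v.
  by move=> hu hv; apply: (Ad_rotation hE hc hexp).
have bC x y : lie_bracket c x y = - lie_bracket c y x by exact: lie_bracketC.
have bxx x : lie_bracket c x x = 0 by exact: lie_bracketxx.
have bD h x y : lie_bracket c h (x + y) = lie_bracket c h x + lie_bracket c h y.
  exact: (lie_bracketDr hE hc hexp).
have bZ h a x : lie_bracket c h (a *: x) = a *: lie_bracket c h x.
  exact: (lie_bracketZr hE hc hexp).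
have CI (C : set (dual E)) : coAd_invariant c C -> forall h l, C l ->
    exists2 m : dual E, C m & forall x, m x = l (T h x).
  move=> CA h l /(CA (expG h)^-1%g) [m Cm Em]; exists m => // x.
  by rewrite Em invgK.
have AI (C : set E) : Ad_invariant c C -> forall h x, C x -> C (T h x).
  by move=> CA h x; exact: CA.
clearbody T; move: (lie_bracket c) ht hp bC bxx bD bZ rot => br ht' hp' bC bxx bD bZ rot.
have pt x : t (p x) := projection_in hp' x.
have pid x : t x -> p x = x := @projection_id _ _ _ _ _ hp' x.
have avt (hs : seq E) x : (forall h, h \in hs -> t h) -> t x -> average T hs x = x.
  exact: (average_cartan bZ rot ht').
have Aav := algebraic_average bC bxx bD bZ TD TZ rot ht' hp'.
have Adense := algebraic_dense bC bD bZ ht'.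
split=> [C oC CA cC|C sC clC cC CA].
  apply: (@open_convex_projection _ _ T t p pc TD TZ pt pid avt _ Aav Adense) => //.
  exact: AI.
apply: (@semi_equicontinuous_projection _ _ T t p pc pt pid _ Aav Adense) => //.
exact: CI.
Qed.
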